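(* Let $p \in (0,\infty)\setminus 2\mathbb{Z}$ (that is, $p>0$ is not an even integer). For every even integer $t$ there exists a constant $c = c(t) > 0$ such that any randomized streaming algorithm which, for an $N\times N$ real matrix $X$ given as a stream of entry updates, outputs with constant probability a value within a factor $1\pm c$ of $\|X\|_p^p$ must use $\Omega_t(N^{1-1/t})$ bits of space (for all sufficiently large $N$).
   Context: Streaming model: an underlying $N\times N$ matrix $X$ (initially zero) receives a sequence of updates $(i,j,\delta)$, each meaning $X_{i,j}\leftarrow X_{i,j}+\delta$; the algorithm must output its estimate at the end of the stream. For $X$ with singular values $\sigma_1(X)\ge\cdots\ge\sigma_N(X)\ge 0$, $\|X\|_p^p=\sum_{i}\sigma_i(X)^p$. The notation $\Omega_t$ means the hidden constant may depend on $t$ (and on $p$). *)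

(* Defs.v *)
From HB Require Import structures.
From mathcomp Require Import all_boot all_order all_algebra.
From mathcomp Require Import complex.
From mathcomp Require Import all_classical all_reals all_analysis.

Set Implicit Arguments.
Unset Strict Implicit.
Unset Printing Implicit Defensive.

Import Order.TTheory GRing.Theory Num.Theory.
Local Open Scope classical_set_scope.
Local Open Scope ring_scope.

Section SingularValues.
Context {R : realType}.

(* The squares of the singular values are the eigenvalues of X^T X, counted with
   multiplicity; the factorisation forces [size s = N]. *)
Definition is_singular_values N (X : 'M[R]_N) (s : seq R) : bool :=
  [&& sorted >=%R s, all (>= 0) s
    & char_poly (X^T *m X) == \prod_(x <- s) ('X - (x ^+ 2)%:P)].

(* The default [::] is irrelevant: see [singular_valuesP]. *)
Definition singular_values N (X : 'M[R]_N) : seq R :=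
  xget [::] [set s | is_singular_values X s].

Definition schatten_pow N (p : R) (X : 'M[R]_N) : R :=
  \sum_(x <- singular_values X) x `^ p.

Lemma gram_eigenvalue_ge0 N (X : 'M[R]_N) (a : R) :
  root (char_poly (X^T *m X)) a -> 0 <= a.
Proof.
rewrite -eigenvalue_root_char => /eigenvalueP[v hv v0].
have sq (w : 'rV[R]_N) : (w *m w^T) 0 0 = \sum_j (w 0 j) ^+ 2.
  by rewrite mxE; apply: eq_bigr => j _; rewrite mxE expr2.
have vv : 0 < (v *m v^T) 0 0.
  rewrite lt_def sq sumr_ge0 ?andbT; last by move=> j _; exact: sqr_ge0.
  apply: contraNneq v0 => h; apply/eqP/rowP => j; rewrite mxE.
  move/eqP: h; rewrite psumr_eq0; last by move=> i _; exact: sqr_ge0.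
  by move=> /allP/(_ j); rewrite mem_index_enum sqrf_eq0 => /(_ isT)/eqP.
have : 0 <= (v *m (X^T *m X) *m v^T) 0 0.
  have -> : v *m (X^T *m X) *m v^T = (v *m X^T) *m (v *m X^T)^T.
    by rewrite trmx_mul trmxK !mulmxA.
  by rewrite sq sumr_ge0 // => j _; exact: sqr_ge0.
by rewrite hv -scalemxAl mxE pmulr_lge0.
Qed.

Lemma char_poly_conj (F : fieldType) N (Q A : 'M[F]_N) :
  Q \in unitmx -> char_poly (invmx Q *m A *m Q) = char_poly A.
Proof.
move=> Qu; pose c := map_mx (@polyC F).
have E : char_poly_mx (invmx Q *m A *m Q)
       = c _ _ (invmx Q) *m char_poly_mx A *m c _ _ Q.
  rewrite /char_poly_mx mulmxBr mulmxBl /c -!map_mxM; congr (_ - _).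
  by rewrite -mulmxA mul_scalar_mx -scalemxAr -map_mxM mulVmx // map_mx1 scalemx1.
rewrite /char_poly E !det_mulmx mulrAC -det_mulmx /c -map_mxM mulVmx //.
by rewrite map_mx1 det1 mul1r.
Qed.

Lemma gram_char_poly_split N (X : 'M[R]_N) :
  exists d : 'I_N -> R, char_poly (X^T *m X) = \prod_i ('X - (d i)%:P).
Proof.
set G := X^T *m X; pose f := real_complex R.
pose Gc : 'M[R[i]]_N := map_mx f G.
have Gh : Gc \is hermsymmx.
  apply: realsym_hermsym.
    by apply/is_hermitianmxP; rewrite expr0 scale1r map_mx_id // map_trmx
      trmx_mul trmxK.
  by apply/mxOverP => i j; rewrite mxE; apply/complex_realP; exists (G i j).
exists (fun i => complex.Re (spectral_diag Gc 0 i)).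
apply: (map_poly_inj f).
rewrite map_char_poly rmorph_prod /=.
have -> : char_poly Gc = \prod_i ('X - (spectral_diag Gc 0 i)%:P).
  have /orthomx_spectralP E := hermitian_normalmx Gh.
  rewrite [in LHS]E char_poly_conj ?spectral_unit //.
  rewrite char_poly_trig ?diag_mx_is_trig //.
  by apply: eq_bigr => i _; rewrite mxE eqxx.
apply: eq_bigr => i _; rewrite rmorphB /= map_polyX map_polyC /=.
have /mxOverP/(_ 0 i)/complex_realP[x hx] := hermitian_spectral_diag_real Gh.
by rewrite hx.
Qed.

Lemma singular_valuesP N (X : 'M[R]_N) :
  is_singular_values X (singular_values X).
Proof.
apply: (@xgetPex _ [::] [set s | is_singular_values X s]) => /=.
have [d dE] := gram_char_poly_split X.
exists (sort >=%R [seq Num.sqrt (d i) | i <- enum 'I_N]).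
apply/and3P; split.
- by apply: sort_sorted => x y; exact: le_total.
- by rewrite all_sort; apply/allP => _ /mapP[i _ ->]; exact: sqrtr_ge0.
- rewrite dE; apply/eqP.
  rewrite [RHS](perm_big _ (permEl (perm_sort _ _))) big_map big_enum /=.
  apply: eq_bigr => i _; rewrite sqr_sqrtr //.
  apply: (@gram_eigenvalue_ge0 _ X).
  by rewrite dE (bigD1 i) //= rootM root_XsubC eqxx.
Qed.

Lemma is_singular_values_uniq N (X : 'M[R]_N) (s1 s2 : seq R) :
  is_singular_values X s1 -> is_singular_values X s2 -> s1 = s2.
Proof.
move=> /and3P[le1 /allP p1 /eqP c1] /and3P[le2 /allP p2 /eqP c2].
have sqrtK (s : seq R) : {in s, forall x, 0 <= x} ->
    [seq Num.sqrt y | y <- [seq x ^+ 2 | x <- s]] = s.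
  move=> sp; rewrite -map_comp -[RHS]map_id; apply/eq_in_map => x xs /=.
  by rewrite sqrtr_sqr ger0_norm // sp.
apply: (sorted_eq ge_trans ge_anti le1 le2).
rewrite -(sqrtK s1 p1) -(sqrtK s2 p2); apply: perm_map.
by apply: prod_XsubC_eq; rewrite !big_map -c1 -c2.
Qed.

End SingularValues.

Section Streaming.
Context {R : realType}.

(* (i, j, delta) *)
Definition update N : Type := ('I_N * 'I_N * R)%type.

Definition stream_matrix N (s : seq (update N)) : 'M[R]_N :=
  \sum_(u <- s) u.2 *: delta_mx u.1.1 u.1.2.

(* All entries lie in D at every moment of the stream, not only at its end.
   [D = setT] allows every real stream; no finite memory copes with entries of
   unbounded size or precision, so that a lower bound on the memory has content
   only for a restricted D such as the integers of absolute value at most N. *)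
Definition stream_over N (D : set R) (s : seq (update N)) : Prop :=
  forall k i j, D (stream_matrix (take k s) i j).

(* A randomized algorithm with b bits of memory.  The sample point w carries all
   the randomness and is not charged to the memory, so that both public and
   private coins are covered; the transition also receives the position k in the
   stream, so that fresh coins may be tossed at every update. *)
Record streaming_algorithm d (W : measurableType d) (N b : nat) := {
  init : W -> b.-tuple bool ;
  step : nat -> W -> b.-tuple bool -> update N -> b.-tuple bool ;
  output : W -> b.-tuple bool -> R ;
  measurable_init : forall m, measurable [set w | init w = m] ;
  measurable_step : forall k m u m', measurable [set w | step k w m u = m'] ;
  measurable_output : forall m, measurable_fun setT (output^~ m) }.

Section Run.
Context d (W : measurableType d) (N b : nat).
Variable A : streaming_algorithm W N b.

Fixpoint run_from (w : W) (k : nat) (m : b.-tuple bool) (s : seq (update N)) :=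
  if s is u :: s' then run_from w k.+1 (step A k w m u) s' else m.

Definition run (w : W) (s : seq (update N)) : R :=
  output A w (run_from w 0 (init A w) s).

Definition good_event (F : 'M[R]_N -> R) (c : R) (s : seq (update N)) : set W :=
  [set w | (1 - c) * F (stream_matrix s) <= run w s <=
           (1 + c) * F (stream_matrix s)].

(* The stream is fixed before the random choices (oblivious adversary). *)
Definition approximates (P : probability W R) (F : 'M[R]_N -> R) (c q : R)
    (D : set R) : Prop :=
  forall s : seq (update N), stream_over D s -> (q%:E <= P (good_event F c s))%E.

End Run.
End Streaming.

(* Main.v *)
(* Hidden hypermatching. Alice holds a set x of vertices among n = 64 t m, Bob a random family of m
   disjoint t-sets of vertices together with, for each of them, a bit; the bits are either all the
   parities of x on the hyperedges or all their complements. Conditioning on Alice's memory state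
   restricts x to a set A of density about 2^-b. By Parseval, Bob's squared advantage is at most the
   sum over nonempty sets S of hyperedges of the average squared Fourier coefficient of A at a
   uniformly random set of size t |S|, and (2, 2r)-hypercontractivity bounds the weight of A at each
   level. The sum stays small as long as b^t is a small multiple of m^(t-1).

   Encoding. For every vertex v and every subset S of {1..t} there are two columns, and Alice puts a
   diagonal 1 in one of them, according to whether v is in x; so each column carries the value of v
   xor a fixed bit. For every hyperedge e and every S whose parity is Bob's bit for e, Bob adds one
   row with t ones, in columns carrying the restriction of x to e shifted by S. As S varies these
   shifts run over all 0/1 vectors of a parity that is the same for all e, hence the Schatten norm is
   a deterministic function of the bit to be guessed. On a gadget with k ones the Gram matrix is
   diag(0/1) + 1 1^T, whose two nontrivial eigenvalues are a +- sqrt(d + k) with a = (1 + t) / 2 and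
   d = ((t - 1) / 2)^2.

   Separation. The two values differ by a multiple of the t-th finite difference in k of
   (a + r)^q + (a - r)^q, where r^2 = d + k and q = p / 2. If it vanished, a polynomial P of degree
   less than t would interpolate at the t + 1 nodes, so (a + r)^q + (a - r)^q - P(r^2) would have
   2 t + 1 zeros in (-a, a]; by Rolle its 2t-th derivative, a nonzero multiple of
   (a + r)^(q - 2t) + (a - r)^(q - 2t) when q is not an integer, would vanish somewhere. *)

From mathcomp Require Import all_boot all_order all_algebra all_fingroup qpoly.
From mathcomp Require Import zify ring lra.

Set Implicit Arguments.
Unset Strict Implicit.
Unset Printing Implicit Defensive.

Import Order.TTheory GRing.Theory Num.Theory.
Local Open Scope ring_scope.

(** * Hypercontractivity *)

Section Inequalities.
Context {R : realFieldType}.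
Implicit Types u v : R.

(** Weighted AM-GM without roots: the case [k = 1] comes by induction from
    [0 <= (u - v) * (u ^+ n.+1 - v ^+ n.+1)]; the general step multiplies by [u] and uses that case
    again. *)
Lemma weighted_AGM u v (k i : nat) : 0 <= u -> 0 <= v ->
  (k + i)%:R * (u ^+ k * v ^+ i) <= k%:R * u ^+ (k + i) + i%:R * v ^+ (k + i).
Proof.
move=> u0 v0.
have base (n : nat) : n.+1%:R * (u * v ^+ n) <= u ^+ n.+1 + n%:R * v ^+ n.+1.
  elim: n => [|n IH]; first by rewrite expr0 mul0r addr0 mulr1 mul1r.
  have key : 0 <= (u - v) * (u ^+ n.+1 - v ^+ n.+1).
    have [uv|/ltW uv] := leP u v.
      by rewrite mulr_le0 // subr_le0 // lerXn2r.
    by rewrite mulr_ge0 // subr_ge0 // lerXn2r.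
  have := ler_wpM2l v0 IH; move: key.
  rewrite !exprS -(natr1 n.+1) -(natr1 n); move: (u ^+ n) (v ^+ n) => a b.
  by nra.
elim: k => [|k IH]; first by rewrite add0n expr0 mul1r mul0r add0r.
have [/eqP|n0] := posnP (k + i)%N.
  by rewrite addn_eq0 => /andP[/eqP -> /eqP ->]; rewrite !expr0 !mulr1 !mul0r !addr0.
rewrite -(ler_pM2l (_ : 0 < (k + i)%:R)) ?ltr0n //.
have := ler_wpM2l u0 IH; have := base (k + i)%N.
rewrite addSn !exprS -(natr1 (k + i)) -(natr1 k) !natrD.
move: (u ^+ (k + i)) (v ^+ (k + i)) (u ^+ k) (v ^+ i) => a b c d h1 h2.
have := ler_wpM2l (_ : 0 <= k%:R + i%:R + 1) h2.
have := ler_wpM2l (ler0n R i) h1.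
rewrite -natrD => h3 /(_ ltac:(by rewrite addr_ge0 ?ler0n)) h4.
move: h3 h4; rewrite !natrD => h3 h4.
lra.
Qed.

(** Hoelder's inequality with exponents (k + i) / k and (k + i) / i, free of roots: scale [u] by [a]
    and [v] by [b], then sum weighted AM-GM termwise. *)
Lemma prod_powers_le (I : finType) (u v : I -> R) (a b c : R) (k i : nat) :
  (forall j, 0 <= u j) -> (forall j, 0 <= v j) -> 0 <= a -> 0 <= b ->
  (0 < k + i)%N ->
  \sum_j u j ^+ (k + i) <= c * a ^+ (k + i) ->
  \sum_j v j ^+ (k + i) <= c * b ^+ (k + i) ->
  \sum_j u j ^+ k * v j ^+ i <= c * (a ^+ k * b ^+ i).
Proof.
move=> u0 v0 a0 b0 ki0 hu hv.
have ex0 (n : nat) : (0 < n)%N -> (0 : R) ^+ n = 0 by rewrite expr0n; case: n.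
have nul (w : I -> R) : (forall j, 0 <= w j) ->
    \sum_j w j ^+ (k + i) <= c * 0 ^+ (k + i) -> forall j, w j = 0.
  move=> w0; rewrite ex0 // mulr0 => le0 j.
  have : \sum_j w j ^+ (k + i) == 0.
    by rewrite eq_le le0 sumr_ge0 // => l _; rewrite exprn_ge0.
  rewrite psumr_eq0; last by move=> l _; rewrite exprn_ge0.
  by move=> /allP/(_ j); rewrite mem_index_enum expf_eq0 ki0 => /(_ isT)/eqP.
move: k i ki0 hu hv nul => [|k] [|i] // ki0 hu hv nul.
- rewrite add0n in hv; rewrite expr0 mul1r.
  by under eq_bigr do rewrite expr0 mul1r.
- rewrite addn0 in hu; rewrite expr0 mulr1.
  by under eq_bigr do rewrite expr0 mulr1.
move: a0; rewrite le0r => /orP[/eqP az|a0].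
  rewrite az in hu *; rewrite ex0 // mul0r mulr0 big1 // => j _.
  by rewrite (nul u u0 hu j) ex0 // mul0r.
move: b0; rewrite le0r => /orP[/eqP bz|b0].
  rewrite bz in hv *; rewrite ex0 // !mulr0 big1 // => j _.
  by rewrite (nul v v0 hv j) ex0 // mulr0.
set K := k.+1 in ki0 hu hv *; set L := i.+1 in ki0 hu hv *.
rewrite [leRHS]mulrC -ler_pdivrMl ?mulr_gt0 ?exprn_gt0 //.
rewrite -(ler_pM2l (_ : 0 < (K + L)%:R)) ?ltr0n //.
rewrite mulr_sumr mulr_sumr.
apply: (@le_trans _ _
  (\sum_j (K%:R * (u j / a) ^+ (K + L) + L%:R * (v j / b) ^+ (K + L)))).
  apply: ler_sum => j _.
  apply: le_trans (weighted_AGM K L _ _); rewrite ?divr_ge0 ?(ltW a0) ?(ltW b0) //.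
  rewrite le_eqVlt; apply/orP; left; apply/eqP; congr (_ * _).
  by rewrite !expr_div_n invfM mulrACA; congr (_ * _); exact: mulrC.
rewrite big_split /= -!mulr_sumr natrD mulrDl lerD // ler_wpM2l //.
  under eq_bigr do rewrite expr_div_n.
  by rewrite -mulr_suml ler_pdivrMr ?exprn_gt0.
under eq_bigr do rewrite expr_div_n.
by rewrite -mulr_suml ler_pdivrMr ?exprn_gt0.
Qed.

(** From [i] to [i.+1] the left side grows by the factor (r - i)(2r - 2i - 1) / ((i + 1)(2i + 1)),
    the right side by (r - i)(2r - 1) / (i + 1), which is at least as large. *)
Lemma bin_even_le (r i : nat) : ('C(2 * r, 2 * i) <= 'C(r, i) * (2 * r).-1 ^ i)%N.
Proof.
elim: i => [|i IH]; first by rewrite !bin0.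
have e1 := mul_bin_left (2 * r) (2 * i).
have e2 := mul_bin_left (2 * r) (2 * i).+1.
have e3 := mul_bin_left r i.
rewrite mulnS !addSn add0n expnS.
have [ri|ri] := leqP r i; first by rewrite bin_small //; lia.
set X := 'C(2 * r, 2 * i) in e1 IH *.
set Y := 'C(2 * r, (2 * i).+1) in e1 e2 *.
set Z := 'C(2 * r, _.+2) in e2 *.
set B := 'C(r, i) in IH e3 *; set B' := 'C(r, i.+1) in e3 *.
set E := ((2 * r).-1 ^ i)%N in IH *.
have h : ((2 * i).+1 * Z * i.+1 <= (2 * i).+1 * (B' * ((2 * r).-1 * E)) * i.+1)%N.
  have -> : ((2 * i).+1 * Z * i.+1 = (2 * r - (2 * i).+1) * (r - i) * X)%N.
    have e4 : (2 * i.+1 * (2 * i).+1 * Z = (2 * r - (2 * i).+1) * (2 * (r - i)) * X)%N.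
      rewrite -[RHS]mulnA mulnBr -e1 mulnCA -e2; nia.
    nia.
  have -> : ((2 * i).+1 * (B' * ((2 * r).-1 * E)) * i.+1
             = (2 * i).+1 * (2 * r).-1 * (r - i) * (B * E))%N.
    by rewrite -[in RHS]mulnA [in RHS](mulnA (r - i)%N) -e3; nia.
  apply: leq_mul => //; apply: leq_mul => //; nia.
by move: h; rewrite leq_pmul2r // leq_pmul2l.
Qed.

End Inequalities.

Lemma card_set_type (T : finType) : #|{: {set T}}| = (2 ^ #|T|)%N.
Proof. by have := card_powerset [set: T]; rewrite powersetT !cardsT. Qed.

Section Fourier.
Context {R : realFieldType} {V : finType}.
Implicit Types (T U x : {set V}) (q : {set V} -> R) (v : V).

(** The Walsh character of the cube of subsets of [V]. *)
Definition chi T x : R := (-1) ^+ #|T :&: x|.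

Definition flip v x : {set V} := if v \in x then x :\ v else v |: x.

Lemma in_flip v x u : (u \in flip v x) = (u == v) (+) (u \in x).
Proof.
rewrite /flip; case: ifPn => vx; rewrite !inE; case: eqP => [->|_] //=.
by rewrite vx.
Qed.

Lemma flipK v : involutive (flip v).
Proof. by move=> x; apply/setP => u; rewrite !in_flip addbA addbb. Qed.

Lemma chiC T x : chi T x = chi x T. Proof. by rewrite /chi setIC. Qed.

Lemma chi_sq T x : chi T x ^+ 2 = 1.
Proof. by rewrite /chi sqrr_sign. Qed.

Lemma chi0 x : chi set0 x = 1. Proof. by rewrite /chi set0I cards0. Qed.

Lemma chi_prod T x : chi T x = \prod_(v in T) (-1) ^+ (v \in x).
Proof.
rewrite prodrXr /chi; congr (_ ^+ _); rewrite -sum1_card big_mkcond /=.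
rewrite [in RHS]big_mkcond; apply: eq_bigr => v _.
by rewrite inE; case: (v \in T); case: (v \in x).
Qed.

Lemma chi_flip v T x : chi T (flip v x) = (-1) ^+ (v \in T) * chi T x.
Proof.
rewrite !chi_prod; have [vT|vT] := boolP (v \in T); last first.
  rewrite mul1r; apply: eq_bigr => u uT; rewrite in_flip.
  by case: eqP => // uv; rewrite -uv uT in vT.
rewrite (bigD1 v) //= [in RHS](bigD1 v) //= mulrA; congr (_ * _).
  by rewrite in_flip eqxx signr_addb.
by apply: eq_bigr => u /andP[_ uv]; rewrite in_flip (negPf uv).
Qed.

Lemma chi_U1 v T x : v \notin T -> chi (v |: T) x = (-1) ^+ (v \in x) * chi T x.
Proof. by move=> vT; rewrite !chi_prod big_setU1. Qed.


Lemma sum_subset_D1 v U q : v \in U ->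
  \sum_(T : {set V} | T \subset U) q T =
  \sum_(T : {set V} | T \subset U :\ v) q T + \sum_(T : {set V} | T \subset U :\ v) q (v |: T).
Proof.
move=> vU; rewrite (bigID (fun T : {set V} => v \in T)) /= addrC; congr (_ + _).
  by apply: eq_bigl => T; rewrite subsetD1.
rewrite (reindex_onto (fun T => v |: T) (fun T => T :\ v)) /=; last first.
  by move=> T /andP[_ vT]; rewrite setD1K.
apply: eq_bigl => T; rewrite subsetD1 setU11 andbT subUset sub1set vU /=.
congr (_ && _); apply/eqP/idP => [<-|vT]; first by rewrite !inE eqxx.
by rewrite setU1K.
Qed.

Lemma sum_even_terms (a : nat -> R) (r : nat) :
  \sum_(i < (2 * r).+1) (1 + (-1) ^+ i) * a i = 2 * \sum_(i < r.+1) a (2 * i)%N.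
Proof.
elim: r => [|r IH]; first by rewrite !big_ord1 expr0.
rewrite big_ord_recr [in RHS]big_ord_recr /= mulrDr -IH.
rewrite [(2 * r.+1)%N]mulnS !addSn add0n big_ord_recr /=.
rewrite !exprS exprM sqrrN !expr1n; ring.
Qed.

Lemma expr_add_sub (g h : R) (r : nat) :
  (g + h) ^+ (2 * r) + (g - h) ^+ (2 * r) =
  2 * \sum_(i < r.+1) 'C(2 * r, 2 * i)%:R * ((g ^+ 2) ^+ (r - i) * (h ^+ 2) ^+ i).
Proof.
rewrite exprDn exprBn -big_split /=.
pose a i := 'C(2 * r, i)%:R * (g ^+ (2 * r - i) * h ^+ i).
transitivity (\sum_(i < (2 * r).+1) (1 + (-1) ^+ i) * a i).
  apply: eq_bigr => i _; rewrite /a -!(mulr_natl (_ * _)).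
  by move: (g ^+ _) (h ^+ i) ((-1) ^+ i) ('C(_, _)%:R) => x y e c; ring.
rewrite sum_even_terms; congr (_ * _); apply: eq_bigr => i _.
by rewrite /a -!exprM mulnBr.
Qed.

(** Bonami's inequality for the exponent 2r, by induction on the set [U] of coordinates on which the
    polynomial depends. Splitting off [v] leaves two polynomials g and h, whose mixed moments are
    bounded by Hoelder and the induction hypothesis. *)
Lemma hypercontractivity (r : nat) U q :
  \sum_(x : {set V}) (\sum_(T : {set V} | T \subset U) q T * chi T x) ^+ (2 * r)
  <= 2 ^+ #|V| * (\sum_(T : {set V} | T \subset U) (2 * r).-1%:R ^+ #|T| * q T ^+ 2) ^+ r.
Proof.
have c2 : \sum_(x : {set V}) 1 = 2 ^+ #|V| :> R.
  by rewrite sumr_const card_set_type natrX.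
have [->|r0] := posnP r.
  by under eq_bigr do rewrite muln0 expr0; rewrite c2 expr0 mulr1.
elim: {U}_.+1 {-2}U (ltnSn #|U|) q => // k IH U Uk q.
have [->|[v vU]] := set_0Vmem U.
  have sub0 F : \sum_(T : {set V} | T \subset set0) F T = F set0 :> R.
    by rewrite (big_pred1 set0) // => T; rewrite subset0.
  rewrite sub0 cards0 expr0 mul1r -exprM.
  under eq_bigr do rewrite sub0 chi0 mulr1.
  by rewrite -c2 mulr_suml; under [leRHS]eq_bigr do rewrite mul1r.
have Uk' : (#|U :\ v| < k)%N by move: Uk; rewrite (cardsD1 v U) vU; lia.
pose g x := \sum_(T : {set V} | T \subset U :\ v) q T * chi T x.
pose h x := \sum_(T : {set V} | T \subset U :\ v) q (v |: T) * chi T x.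
pose A := \sum_(T : {set V} | T \subset U :\ v) (2 * r).-1%:R ^+ #|T| * q T ^+ 2.
pose B := \sum_(T : {set V} | T \subset U :\ v) (2 * r).-1%:R ^+ #|T| * q (v |: T) ^+ 2.
have vn T : T \subset U :\ v -> v \notin T by rewrite subsetD1 => /andP[].
have split x : \sum_(T : {set V} | T \subset U) q T * chi T x = g x + (-1) ^+ (v \in x) * h x.
  rewrite (sum_subset_D1 _ vU); congr (_ + _); rewrite mulr_sumr.
  by apply: eq_bigr => T /vn vT; rewrite chi_U1 // mulrCA.
have -> : \sum_(T : {set V} | T \subset U) (2 * r).-1%:R ^+ #|T| * q T ^+ 2
          = A + (2 * r).-1%:R * B.
  rewrite (sum_subset_D1 _ vU); congr (_ + _); rewrite mulr_sumr.
  by apply: eq_bigr => T /vn vT; rewrite cardsU1 vT add1n exprS mulrA.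
under eq_bigr do rewrite split.
have gf x : g (flip v x) = g x.
  by apply: eq_bigr => T /vn vT; rewrite chi_flip (negPf vT) mul1r.
have hf x : h (flip v x) = h x.
  by apply: eq_bigr => T /vn vT; rewrite chi_flip (negPf vT) mul1r.
(* Pairing [x] with [flip v x] removes the odd powers of [h]. *)
have -> : \sum_(x : {set V}) (g x + (-1) ^+ (v \in x) * h x) ^+ (2 * r) =
  \sum_(x : {set V}) \sum_(i < r.+1) 'C(2 * r, 2 * i)%:R *
     ((g x ^+ 2) ^+ (r - i) * (h x ^+ 2) ^+ i).
  apply: (mulfI (_ : (2 : R) != 0)); first by rewrite pnatr_eq0.
  rewrite [RHS]mulr_sumr [LHS]mulr_natl mulr2n.
  rewrite [X in _ + X](reindex_inj (inv_inj (flipK v))) /= -big_split /=.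
  apply: eq_bigr => x _; rewrite -expr_add_sub gf hf in_flip eqxx.
  by case: (v \in x); rewrite /= ?expr1 ?expr0 ?mulN1r ?mul1r // addrC.
(* Comparison term by term with the binomial expansion of (A + (2r - 1) B)^r. *)
rewrite exchange_big /= [in leRHS](exprDn A) [leRHS]mulr_sumr.
apply: ler_sum => -[i /=]; rewrite ltnS => ir _.
rewrite -mulr_sumr exprMn -[_ *+ 'C(r, i)]mulr_natl.
have A0 : 0 <= A by apply: sumr_ge0 => T _; rewrite mulr_ge0 ?sqr_ge0 ?exprn_ge0.
have B0 : 0 <= B by apply: sumr_ge0 => T _; rewrite mulr_ge0 ?sqr_ge0 ?exprn_ge0.
have := @prod_powers_le R _ (fun x => g x ^+ 2) (fun x => h x ^+ 2) A B (2 ^+ #|V|) (r - i) i.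
rewrite subnK // => /(_ (fun=> sqr_ge0 _) (fun=> sqr_ge0 _) A0 B0 r0).
have E (f : {set V} -> R) : \sum_(x : {set V}) (f x ^+ 2) ^+ r = \sum_(x : {set V}) f x ^+ (2 * r).
  by apply: eq_bigr => x _; rewrite exprM.
rewrite !E => /(_ (IH _ Uk' _) (IH _ Uk' _)) H.
apply: le_trans (ler_wpM2l (ler0n _ _) H) _.
have := bin_even_le r i; rewrite -(ler_nat R) natrM natrX => H2.
apply: le_trans (ler_wpM2r _ H2) _.
  by rewrite !mulr_ge0 ?exprn_ge0 ?ler0n.
by rewrite le_eqVlt; apply/orP; left; apply/eqP; ring.
Qed.

End Fourier.

(** * Fourier weight of a dense set on one level *)

Section Level.
Context {R : realFieldType}.

(** Sum the AM-GM inequality between each [u i] and the mean [b]. *)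
Lemma power_mean_le (I : finType) (A : {set I}) (u : I -> R) (k : nat) :
  (forall i, 0 <= u i) ->
  (\sum_(i in A) u i) ^+ k.+1 <= #|A|%:R ^+ k * \sum_(i in A) u i ^+ k.+1.
Proof.
move=> u0; have [->|A0] := eqVneq A set0.
  by rewrite !big_set0 expr0n mulr0.
have a0 : 0 < #|A|%:R :> R by rewrite ltr0n card_gt0.
set s := \sum_(i in A) u i; pose b := s / #|A|%:R.
have sb : s = #|A|%:R * b by rewrite mulrC divfK // gt_eqF.
have b0 : 0 <= b by rewrite divr_ge0 ?ler0n ?sumr_ge0.
have H : \sum_(i in A) (1 + k)%:R * (u i ^+ 1 * b ^+ k)
    <= \sum_(i in A) (1%:R * u i ^+ (1 + k) + k%:R * b ^+ (1 + k)).
  by apply: ler_sum => i _; apply: weighted_AGM.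
rewrite -mulr_sumr big_split /= -!mulr_sumr -mulr_suml mul1r sumr_const -/s in H.
have {}H : #|A|%:R * b ^+ k.+1 <= \sum_(i in A) u i ^+ k.+1.
  move: H; rewrite -[_ *+ #|A|]mulr_natl sb natrD [(1 + k)%N]add1n exprS.
  by move: (b ^+ k) (\sum_(i in A) _) => x y; lra.
by rewrite sb exprMn exprSr -mulrA ler_wpM2l ?exprn_ge0.
Qed.

Lemma cauchy_schwarz_sum (I : finType) (f g : I -> R) :
  (\sum_i f i * g i) ^+ 2 <= (\sum_i f i ^+ 2) * (\sum_i g i ^+ 2).
Proof.
set a := \sum_i f i ^+ 2; set b := \sum_i g i ^+ 2; set s := \sum_i _ * _.
have a0 : 0 <= a by apply: sumr_ge0 => i _; exact: sqr_ge0.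
have H : 0 <= \sum_i (a * g i - s * f i) ^+ 2.
  by apply: sumr_ge0 => i _; exact: sqr_ge0.
have E : \sum_i (a * g i - s * f i) ^+ 2 = a * (a * b - s ^+ 2).
  transitivity (\sum_i (a ^+ 2 * g i ^+ 2 + (- (2 * a * s)) * (f i * g i) + s ^+ 2 * f i ^+ 2)).
    by apply: eq_bigr => i _; ring.
  by rewrite !big_split /= -!mulr_sumr -/a -/b -/s; ring.
move: a0; rewrite le0r => /orP[/eqP az|a0].
  suff -> : s = 0 by rewrite expr0n mulr_ge0 // ?az //; apply: sumr_ge0 => i _; exact: sqr_ge0.
  apply: big1 => i _; move/eqP: az; rewrite psumr_eq0; last by move=> j _; exact: sqr_ge0.
  by move=> /allP/(_ i); rewrite mem_index_enum sqrf_eq0 => /(_ isT)/eqP ->; rewrite mul0r.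
by move: H; rewrite E pmulr_rge0 // subr_ge0.
Qed.

Context {V : finType}.
Implicit Types (A : {set {set V}}) (T x : {set V}).

(** The Fourier coefficient of the indicator of [A], without the factor 2^-|V|. *)
Definition fourier_sum A T : R := \sum_(x in A) chi T x.

Definition level_weight A (j : nat) : R :=
  \sum_(T : {set V} | #|T| == j) fourier_sum A T ^+ 2.

Lemma level_weight_ge0 A j : 0 <= level_weight A j.
Proof. by apply: sumr_ge0 => T _; exact: sqr_ge0. Qed.

(** Duality: W is the sum over [A] of the level-j polynomial Q whose coefficients are the Fourier
    sums. The power mean inequality on [A] and hypercontractivity on the whole cube bound W^(2r) by
    a multiple of W^r, and W^r cancels. *)
Lemma level_weight_expr A (j r : nat) : (0 < r)%N ->
  level_weight A j ^+ r <=
    #|A|%:R ^+ (2 * r).-1 * (2 ^+ #|V| * (2 * r).-1%:R ^+ (j * r)).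
Proof.
move=> r0; set W := level_weight A j.
have W0 : 0 <= W by exact: level_weight_ge0.
move: (W0); rewrite le0r => /orP[/eqP ->|Wgt0].
  by rewrite expr0n eqn0Ngt r0 /= !mulr_ge0 ?exprn_ge0.
pose q T := if #|T| == j then fourier_sum A T else 0.
pose Q x := \sum_(T : {set V} | T \subset [set: V]) q T * chi T x.
have WQ : W = \sum_(x in A) Q x.
  rewrite /Q exchange_big /= /W /level_weight big_mkcond /=.
  apply: eq_big => [T|T _]; first by rewrite subsetT.
  rewrite -mulr_sumr -/(fourier_sum A T) /q; case: eqP => _; last by rewrite mul0r.
  by rewrite expr2.
have Wq : \sum_(T : {set V} | T \subset [set: V]) (2 * r).-1%:R ^+ #|T| * q T ^+ 2
    = (2 * r).-1%:R ^+ j * W.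
  rewrite /W /level_weight mulr_sumr [RHS]big_mkcond /=.
  apply: eq_big => [T|T _]; first by rewrite subsetT.
  by rewrite /q; case: eqP => [->|_] //; rewrite expr0n mulr0.
rewrite -(ler_pM2l (exprn_gt0 r Wgt0)) -exprD addnn -mul2n.
have r2 : (2 * r)%N = (2 * r).-1.+1 by rewrite prednK // muln_gt0.
have abs_even (y : R) : y ^+ (2 * r) = `|y| ^+ (2 * r).
  by rewrite !exprM real_normK ?num_real.
apply: (@le_trans _ _ (#|A|%:R ^+ (2 * r).-1 * \sum_(x in A) Q x ^+ (2 * r))).
  rewrite abs_even (ger0_norm W0).
  apply: (@le_trans _ _ ((\sum_(x in A) `|Q x|) ^+ (2 * r))).
    apply: lerXn2r; rewrite ?nnegrE //; first by apply: sumr_ge0.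
    rewrite WQ; by apply: le_trans (ler_norm_sum _ _ _); exact: ler_norm.
  rewrite {1}r2; apply: le_trans (power_mean_le _ _ _) _ => //.
  by rewrite -r2; under eq_bigr do rewrite -abs_even.
rewrite mulrCA ler_wpM2l ?exprn_ge0 //.
apply: (@le_trans _ _ (\sum_(x : {set V}) Q x ^+ (2 * r))).
  rewrite [leRHS](bigID (mem A)) /= lerDl sumr_ge0 // => x _.
  by rewrite exprM exprn_ge0 // sqr_ge0.
apply: le_trans (hypercontractivity _ _ _) _.
by rewrite Wq exprMn -exprM mulrA mulrC.
Qed.

(** The leftover factor 2^|V| / |A| is at most 2^c <= 2^(jr); the r-th root turns it into a factor 2
    per unit of level. *)
Lemma level_weight_le A (j r c : nat) : (0 < r)%N -> (c <= j * r)%N ->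
  (2 ^ #|V| <= #|A| * 2 ^ c)%N ->
  level_weight A j <= #|A|%:R ^+ 2 * (2 * (2 * r).-1)%:R ^+ j.
Proof.
move=> r0 cj Ac; rewrite -(@ler_pXn2r _ r) ?nnegrE ?level_weight_ge0 //; last first.
  by rewrite mulr_ge0 ?exprn_ge0.
apply: le_trans (level_weight_expr _ _ r0) _.
rewrite [leRHS]exprMn -!exprM natrM exprMn.
have r2 : (2 * r)%N = (2 * r).-1.+1 by rewrite prednK // muln_gt0.
rewrite [in leRHS]r2 /= exprSr -mulrA ler_wpM2l ?exprn_ge0 // mulrA ler_wpM2r ?exprn_ge0 //.
rewrite -!natrX -natrM ler_nat; apply: leq_trans Ac _.
by rewrite leq_mul2l leq_exp2l // cj orbT.
Qed.

End Level.

(** * The hidden hypermatching problem *)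

Lemma card_set_eq_perm (V : finType) (B T : {set V}) :
  #|B| = #|T| -> exists s : {perm V}, s @: B = T.
Proof.
have [k] := ubnP #|B :\: T|; elim: k B => // k IH B Bk BT.
have [BT0|[b]] := set_0Vmem (B :\: T).
  exists 1%g; have -> : T = B.
    by apply/esym/eqP; rewrite eqEcard BT leqnn andbT -setD_eq0 BT0.
  by rewrite -[RHS]imset_id; apply: eq_imset => v; rewrite perm1.
rewrite inE => /andP[bT bB].
have [TB0|[c]] := set_0Vmem (T :\: B).
  have : T :==: B by rewrite eqEcard BT leqnn andbT -setD_eq0 TB0.
  by move=> /eqP TB; rewrite TB bB in bT.
rewrite inE => /andP[cB cT].
have E : tperm b c @: B = c |: (B :\ b).
  apply/eqP; rewrite eqEcard card_imset ?cardsU1; last exact: perm_inj.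
  rewrite !inE (negPf cB) andbF /= (cardsD1 b B) bB leqnn andbT.
  apply/subsetP => _ /imsetP[v vB ->]; rewrite !inE; case: tpermP => [_|vc|/eqP vb /eqP vc].
  - by rewrite eqxx.
  - by rewrite -vc vB in cB.
  - by rewrite vb vB orbT.
have [||s sE] := IH (tperm b c @: B).
- rewrite -ltnS; apply: leq_trans Bk; rewrite ltnS E; apply: proper_card.
  apply/properP; split.
    by apply/subsetP => v; rewrite !inE; case: eqP => [->|_]; rewrite ?cT //= => /andP[-> /andP[_ ->]].
  by exists b; rewrite !inE ?bT ?bB // eqxx /= orbF; apply: contraNN bT => /eqP ->.
- by rewrite card_imset //; exact: perm_inj.
- exists (tperm b c * s)%g; rewrite -sE -imset_comp.
  by apply: eq_imset => v; rewrite permM.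
Qed.

Lemma card_perm_type (V : finType) : #|{: {perm V}}| = (#|V|)`!.
Proof.
rewrite -cardsT -card_perm; apply: eq_card => s.
by rewrite !inE; apply/esym/subsetP => v _; rewrite inE.
Qed.

Section PermAverage.
Context {R : realFieldType} {V : finType}.

(** The symmetric group is transitive on sets of a given size, so a random permutation carries [B]
    to a uniformly random set of that size. *)
Lemma sum_perm_imset (F : {set V} -> R) (B : {set V}) :
  'C(#|V|, #|B|)%:R * \sum_(s : {perm V}) F (s @: B) =
  (#|V|)`!%:R * \sum_(T : {set V} | #|T| == #|B|) F T.
Proof.
have inv (T : {set V}) : #|T| = #|B| ->
    \sum_(s : {perm V}) F (s @: B) = \sum_(s : {perm V}) F (s @: T).
  move=> /esym/card_set_eq_perm[s0 <-]; rewrite (reindex_inj (mulgI s0)) /=.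
  by apply: eq_bigr => s _; rewrite -imset_comp; congr F; apply: eq_imset => v; rewrite permM.
transitivity (\sum_(T : {set V} | #|T| == #|B|) \sum_(s : {perm V}) F (s @: T)).
  rewrite mulr_natl -card_draws cardsE -sumr_const.
  by apply: eq_bigr => T /eqP; exact: inv.
rewrite exchange_big /= mulr_natl.
rewrite -card_perm_type -sumr_const; apply: eq_bigr => s _.
have inj : injective (fun T : {set V} => s @: T) by exact: imset_inj (@perm_inj _ s).
rewrite [RHS](reindex_inj inj) /=; apply: eq_bigl => T.
by rewrite card_imset //; exact: perm_inj.
Qed.

Lemma parseval (f : {set V} -> R) :
  2 ^+ #|V| * \sum_z f z ^+ 2 = \sum_(S : {set V}) (\sum_z f z * chi S z) ^+ 2.
Proof.
have orth (z z' : {set V}) :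
    \sum_(S : {set V}) chi S z * chi S z' = (z == z')%:R * 2 ^+ #|V| :> R.
  have [->|zz] := eqVneq z z'.
    rewrite mul1r (eq_bigr (fun=> 1)); last by move=> S _; rewrite -expr2 chi_sq.
    by rewrite sumr_const card_set_type natrX.
  rewrite mul0r.
  have [v vz] : exists v, (v \in z) != (v \in z').
    apply/existsP; rewrite -negb_forall; apply: contraNN zz => /forallP H.
    by apply/eqP/setP => v; apply/eqP.
  (* Toggling [v] in [S] is a bijection that changes the sign of every term. *)
  have : \sum_(S : {set V}) chi S z * chi S z' = - \sum_(S : {set V}) chi S z * chi S z' :> R.
    rewrite [LHS](reindex_inj (inv_inj (flipK v))) /= -sumrN.
    apply: eq_bigr => S _; rewrite ![chi (flip _ _) _]chiC !chi_flip ![chi _ S]chiC.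
    by rewrite mulrACA -signr_addb -negb_eqb vz mulN1r.
  by move/eqP; rewrite -addr_eq0 -mulr2n mulrn_eq0 => /eqP.
transitivity (\sum_(S : {set V}) \sum_z \sum_z' (f z * f z') * (chi S z * chi S z')); last first.
  apply: eq_bigr => S _; rewrite expr2 mulr_suml; apply: eq_bigr => z _.
  by rewrite mulr_sumr; apply: eq_bigr => z' _; rewrite mulrACA.
rewrite exchange_big /= mulr_sumr; apply: eq_bigr => z _.
rewrite exchange_big /= (bigD1 z) //= [X in _ + X]big1 ?addr0 => [|z' zz'].
  by rewrite -mulr_sumr orth eqxx mul1r mulrC expr2.
by rewrite -mulr_sumr orth eq_sym (negPf zz') mul0r mulr0.
Qed.

End PermAverage.

Section HiddenMatching.
Context {R : realFieldType} {V E J : finType} (pos : E * J -> V).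
Hypothesis pos_inj : injective pos.
Implicit Types (s : {perm V}) (x : {set V}) (S z : {set E}).

(** A random hypermatching is encoded as the fixed layout [pos] moved by a random permutation
    [s]. *)
Definition parities s x : {set E} :=
  [set e | odd #|[set j | s (pos (e, j)) \in x]|].

Definition block S : {set V} := pos @: finset.setX S [set: J].

Lemma card_block S : #|block S| = (#|S| * #|J|)%N.
Proof. by rewrite card_imset // cardsX cardsT. Qed.

(** The hyperedges are disjoint, so a product of parities over [S] is the parity on their union.
    Characters of Bob's data thus become Fourier coefficients on Alice's side. *)
Lemma chi_parities s x S : chi S (parities s x) = chi (s @: block S) x :> R.
Proof.
rewrite !chi_prod /block -imset_comp big_imset /=; last first.
  by move=> u v _ _ /perm_inj /pos_inj.
transitivity (\prod_(e in S) \prod_(j in [set: J]) (-1) ^+ (s (pos (e, j)) \in x) : R).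
  apply: eq_bigr => e _; rewrite inE signr_odd prodrXr; congr (_ ^+ _).
  rewrite -sum1_card big_mkcond [RHS]big_mkcond.
  by apply: eq_bigr => j _; rewrite !inE; case: (_ \in x).
rewrite pair_big /=; apply: eq_big => [[e j]|[e j] _] //=.
by rewrite !inE.
Qed.

(* The two terms are the transcripts on which Bob sees the parities themselves or their
   complements; [G] is his guess. *)
Definition advantage (A : {set {set V}}) (G : {perm V} -> {set E} -> bool) : R :=
  \sum_s \sum_(x in A) ((G s (parities s x))%:R - (G s (~: parities s x))%:R).

(** Cauchy-Schwarz over the pairs (s, z) eliminates the guess, Parseval in z passes to Fourier sums
    at unions of hyperedges, and averaging over [s] makes each union a uniformly random set. *)
Lemma advantage_sq (A : {set {set V}}) (G : {perm V} -> {set E} -> bool) :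
  (forall S : {set E}, (#|S| * #|J| <= #|V|)%N) ->
  advantage A G ^+ 2 <= (#|V|)`!%:R ^+ 2 *
    \sum_(S : {set E} | S != set0)
      level_weight A (#|S| * #|J|) / 'C(#|V|, #|S| * #|J|)%:R.
Proof.
move=> small.
pose D s z : R := \sum_(x in A | parities s x == z) 1.
(* Subtracting 1/2 leaves the advantage unchanged and makes the square of the guess constant. *)
pose g s z : R := (G s z)%:R - 2^-1.
have gsq s z : g s z ^+ 2 = 4^-1.
  by rewrite /g; case: (G s z); rewrite /= ?expr2; field.
have advE : advantage A G =
    \sum_(sz : {perm V} * {set E}) (D sz.1 sz.2 - D sz.1 (~: sz.2)) * g sz.1 sz.2.
  rewrite -(pair_big xpredT xpredT (fun s z => (D s z - D s (~: z)) * g s z)) /=.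
  apply: eq_bigr => s _.
  have DE (F : {set E} -> R) : \sum_z D s z * F z = \sum_(x in A) F (parities s x).
    rewrite (partition_big (parities s) xpredT) //=; apply: eq_bigr => z _.
    by rewrite mulr_suml; apply: eq_bigr => x /andP[_ /eqP ->]; rewrite mul1r.
  under [RHS]eq_bigr do rewrite mulrBl.
  rewrite [RHS]sumrB [X in _ = _ - X](reindex_inj (inv_inj (@setCK E))) /=.
  under [X in _ = _ - X]eq_bigr do rewrite setCK.
  rewrite !DE -sumrB; apply: eq_bigr => x _.
  by rewrite /g opprB addrA subrK.
have DS s S : \sum_z D s z * chi S z = fourier_sum A (s @: block S).
  rewrite /fourier_sum (partition_big (parities s) xpredT) //=; apply: eq_bigr => z _.
  rewrite mulr_suml; apply: eq_bigr => x /andP[_ /eqP <-].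
  by rewrite mul1r chi_parities.
have chiCS S z : chi S (~: z) = (-1) ^+ #|S| * chi S z :> R.
  rewrite !chi_prod -prodr_const -big_split /=; apply: eq_bigr => e _.
  by rewrite inE; case: (e \in z); rewrite /= ?expr0 ?expr1 ?mulr1 // mulrNN mulr1.
have DCS s S : \sum_z (D s z - D s (~: z)) * chi S z
    = (1 - (-1) ^+ #|S|) * fourier_sum A (s @: block S).
  under eq_bigr do rewrite mulrBl.
  rewrite sumrB [X in _ - X = _](reindex_inj (inv_inj (@setCK E))) /=.
  under [X in _ - X = _]eq_bigr do rewrite setCK chiCS mulrCA.
  by rewrite -mulr_sumr DS mulrBl mul1r.
rewrite advE; apply: le_trans (cauchy_schwarz_sum _ _) _.
under [X in _ * X]eq_bigr do rewrite gsq.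
rewrite sumr_const.
rewrite card_prod card_perm_type card_set_type.
rewrite -(pair_big xpredT xpredT (fun s z => (D s z - D s (~: z)) ^+ 2)) /=.
rewrite -[4^-1 *+ _]mulr_natl natrM natrX.
set X := \sum_s _.
have -> : X * ((#|V|)`!%:R * 2 ^+ #|E| / 4) = (#|V|)`!%:R * 4^-1 * (2 ^+ #|E| * X) by ring.
have -> : 2 ^+ #|E| * X =
    \sum_(s : {perm V}) \sum_(S : {set E}) ((1 - (-1) ^+ #|S|) * fourier_sum A (s @: block S)) ^+ 2.
  rewrite mulr_sumr; apply: eq_bigr => s _; rewrite parseval.
  by apply: eq_bigr => S _; rewrite DCS.
rewrite expr2 -mulrA -[leRHS]mulrA ler_wpM2l ?ler0n //.
rewrite ler_pdivrMl // exchange_big /= mulrA mulr_sumr.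
(* The empty set drops out: the two transcripts have the same total mass. *)
rewrite (bigD1 set0) //= big1 ?add0r => [|s _]; last first.
  by rewrite cards0 expr0 subrr mul0r expr0n.
apply: ler_sum => S S0.
(* The squared sign factor is 0 or 4, according to the parity of |S|. *)
apply: (@le_trans _ _ (4 * \sum_(s : {perm V}) fourier_sum A (s @: block S) ^+ 2)).
  rewrite mulr_sumr; apply: ler_sum => s _; rewrite exprMn ler_wpM2r ?sqr_ge0 //.
  by case: (odd #|S|) (signr_odd R #|S|) => <-; rewrite /= ?expr1 ?expr0; lra.
rewrite -mulrA ler_pM2l // mulrA ler_pdivlMr ?ltr0n ?bin_gt0 // mulrC.
by rewrite -card_block (@sum_perm_imset R V (fun T => fourier_sum A T ^+ 2)).
Qed.

End HiddenMatching.

(** * Binomial estimates and the sum over sets of hyperedges *)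

Lemma bin_lower_bound (n k : nat) : (k <= n)%N -> (n ^ k <= 'C(n, k) * k ^ k)%N.
Proof.
elim: k n => [|k IH] [|n] //.
rewrite ltnS => kn; rewrite [(k.+1 ^ _)%N]expnS mulnA [('C(_, _) * _)%N]mulnC -mul_bin_diag.
rewrite expnS -mulnA leq_mul2l /=.
have [->|k0] := posnP k; first by rewrite !expn0 bin0.
have kk : (0 < k ^ k)%N by rewrite expn_gt0 k0.
rewrite -(leq_pmul2r kk) mulnAC; apply: leq_trans (leq_mul (IH n kn) (leqnn _)).
by rewrite -!expnMn leq_exp2r // mulSn mulnS leq_add2r.
Qed.

(** k^k <= (k + 1)...(2k) = C(2k, k) k!, and C(2k, k) <= 2^(2k). The constant 4 stands in for e. *)
Lemma expn_self_le (k : nat) : (k ^ k <= 4 ^ k * k`!)%N.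
Proof.
have H : (k ^ k <= (k + k) ^_ k)%N.
  have gen j i : (j <= i)%N -> (i ^ j <= (i + j) ^_ j)%N.
    elim: j i => // j IH i ji; rewrite addnS ffactSS expnS.
    apply: leq_mul; first by clear -ji; lia.
    apply: leq_trans (IH i (ltnW ji)) _; exact: leqnn.
  exact: gen.
apply: leq_trans H _; rewrite -bin_ffact leq_mul2r; apply/orP; right.
rewrite [4%N](_ : _ = 2 ^ 2)%N // -expnM mul2n -addnn.
rewrite -[X in ('C(X, _))%N]card_ord -card_draws -[in leqRHS](card_ord (k + k)) -card_set_type.
exact: max_card.
Qed.

Lemma bin_upper_bound (m k : nat) : ('C(m, k) * k ^ k <= (4 * m) ^ k)%N.
Proof.
apply: leq_trans (leq_mul (leqnn _) (expn_self_le k)) _.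
rewrite mulnCA expnMn leq_mul2l bin_ffact.
have [km|mk] := leqP k m; last by rewrite ffact_small ?orbT.
apply/orP; right; elim: k m km => // k IH [|m] // km.
rewrite ffactSS expnS leq_mul2l /=; apply: leq_trans (IH m km) _.
by case: k {IH km} => // k; rewrite leq_exp2r.
Qed.

Section HyperedgeSum.
Context {R : realFieldType}.

Lemma expr_add_le (a b : R) (k : nat) : 0 <= a -> 0 <= b ->
  (a + b) ^+ k <= (2 * a) ^+ k + (2 * b) ^+ k.
Proof.
move=> a0 b0; have [ab|/ltW ab] := leP a b.
  apply: (@le_trans _ _ ((2 * b) ^+ k)).
    by apply: lerXn2r; rewrite ?nnegrE ?addr_ge0 ?mulr_ge0 //; lra.
  by rewrite lerDr exprn_ge0 // mulr_ge0.
apply: (@le_trans _ _ ((2 * a) ^+ k)).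
  by apply: lerXn2r; rewrite ?nnegrE ?addr_ge0 ?mulr_ge0 //; lra.
by rewrite lerDl exprn_ge0 // mulr_ge0.
Qed.

Lemma sum_sets_by_card (E : finType) (F : nat -> R) :
  \sum_(S : {set E}) F #|S| = \sum_(k < #|E|.+1) 'C(#|E|, k)%:R * F k.
Proof.
pose idx (S : {set E}) : 'I_#|E|.+1 := inord #|S|.
have idxE S : idx S = #|S| :> nat by rewrite inordK // ltnS max_card.
rewrite (partition_big idx xpredT) //=; apply: eq_bigr => k _.
rewrite mulr_natl -card_draws cardsE -sumr_const.
by apply: eq_big => [S|S /eqP <-]; [rewrite unfold_in /= -idxE | rewrite idxE].
Qed.

Lemma sum_nonempty_sets (E : finType) (F : nat -> R) :
  \sum_(S : {set E} | S != set0) F #|S| = \sum_(k < #|E|) 'C(#|E|, k.+1)%:R * F k.+1.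
Proof.
pose F' k := if k == 0%N then 0 else F k.
transitivity (\sum_(S : {set E}) F' #|S|).
  by rewrite big_mkcond; apply: eq_bigr => S _; rewrite /F' cards_eq0; case: eqP.
by rewrite sum_sets_by_card big_ord_recl /= mulr0 add0r.
Qed.

(* Each summand is at most [(4 m y / k) ^ k] with [y = ((2 t k + 4 c) / n) ^ t
   <= (k / m) ^ 2 / 256 + v / m]. *)
Lemma hyperedge_term_le (m t k c : nat) (v : R) :
  (1 < t)%N -> (0 < k <= m)%N -> 0 <= v -> v <= 16^-1 ->
  c%:R ^+ t <= v * m%:R ^+ t.-1 ->
  'C(m, k)%:R * ((2 * t * k + 4 * c)%:R / (64 * t * m)%:R) ^+ (k * t)
  <= (m%:R^-1 + 16 * v) * 2^-1 ^+ k.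
Proof.
move=> t1 /andP[k0 km] v0 v1 hc.
have m0 : (0 < m)%N by exact: leq_trans km.
have mR : 0 < m%:R :> R by rewrite ltr0n.
have kR : 0 < k%:R :> R by rewrite ltr0n.
have tR : 1 <= t%:R :> R by rewrite ler1n ltnW.
set x : R := k%:R / m%:R.
have x0 : 0 <= x by rewrite divr_ge0.
have x1 : x <= 1 by rewrite ler_pdivrMr // mul1r ler_nat.
have y_le : ((2 * t * k + 4 * c)%:R / (64 * t * m)%:R) ^+ t <= x ^+ 2 / 256 + v / m%:R.
  have -> : (2 * t * k + 4 * c)%:R / (64 * t * m)%:R = x / 32 + c%:R / (16 * t%:R * m%:R).
    by rewrite /x natrD !natrM; field; rewrite !gt_eqF //; lra.
  have a0 : 0 <= x / 32 by lra.
  have b0 : 0 <= c%:R / (16 * t%:R * m%:R) :> R.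
    by rewrite divr_ge0 // !mulr_ge0.
  apply: le_trans (expr_add_le _ a0 b0) _; apply: lerD.
    (* As x / 16 <= 1 and t >= 2, the exponent t may be lowered to 2. *)
    have -> : 2 * (x / 32) = x / 16 by field.
    have -> : x ^+ 2 / 256 = (x / 16) ^+ 2 by field.
    by apply: ler_wiXn2l; lra || exact: t1.
  (* The hypothesis on c^t supplies v / m, and (8t)^-t is at most 1. *)
  have -> : 2 * (c%:R / (16 * t%:R * m%:R)) = (c%:R / m%:R) * (8 * t%:R)^-1 :> R.
    by field; rewrite !gt_eqF //; lra.
  rewrite exprMn -[leRHS]mulr1; apply: ler_pM.
  - by rewrite exprn_ge0 // divr_ge0.
  - by rewrite exprn_ge0 // invr_ge0; lra.
  - rewrite expr_div_n ler_pdivrMr ?exprn_gt0 //.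
    by rewrite -[X in m%:R ^+ X](prednK (ltnW t1)) exprS mulrA divfK ?gt_eqF.
  - rewrite exprn_ile1 ?invr_ge0 //; first by lra.
    by rewrite invf_le1; lra.
set y := _ ^+ t in y_le.
have y0 : 0 <= y by rewrite exprn_ge0 // divr_ge0.
rewrite [(k * t)%N]mulnC exprM -/y.
have step : 'C(m, k)%:R * y ^+ k <= (x / 64 + 4 * v) ^+ k.
  apply: (@le_trans _ _ ((4 * m%:R / k%:R * y) ^+ k)).
    rewrite exprMn ler_wpM2r ?(exprn_ge0 k y0) // expr_div_n ler_pdivlMr ?exprn_gt0 //.
    by rewrite -!(natrX, natrM) ler_nat bin_upper_bound.
  apply: lerXn2r; rewrite ?nnegrE.
  - by apply: mulr_ge0 => //; rewrite divr_ge0 ?mulr_ge0.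
  - by lra.
  apply: le_trans (ler_wpM2l _ y_le) _; first by rewrite divr_ge0 // mulr_ge0.
  have -> : 4 * m%:R / k%:R * (x ^+ 2 / 256 + v / m%:R) = x / 64 + 4 * v / k%:R.
    by rewrite /x; field; rewrite !gt_eqF.
  by rewrite lerD2l ler_pdivrMr // ler_peMr ?mulr_ge0 // ler1n.
apply: le_trans step _.
apply: le_trans (expr_add_le _ _ _) _; [by lra | by lra |].
rewrite [leRHS]mulrDl; apply: lerD.
  have -> : 2 * (x / 64) = x * 32^-1 by field.
  rewrite exprMn.
  (* x^k <= x = k / m yields the factor 1 / m, and k <= 2^k is absorbed by 32^-k. *)
  have xk : x ^+ k <= x by apply: ler_iXnr.
  have k2 : k%:R <= 2 ^+ k :> R by rewrite -natrX ler_nat ltnW // ltn_expl.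
  apply: (@le_trans _ _ (x * 32^-1 ^+ k)); first by rewrite ler_wpM2r ?exprn_ge0 ?invr_ge0.
  rewrite /x [k%:R / _]mulrC -mulrA ler_wpM2l ?invr_ge0 ?ler0n //.
  apply: (@le_trans _ _ (2 ^+ k * 32^-1 ^+ k)); first by rewrite ler_wpM2r ?exprn_ge0 ?invr_ge0.
  by rewrite -exprMn; apply: lerXn2r; rewrite ?nnegrE; lra.
have -> : 2 * (4 * v) = 8 * v by ring.
(* One factor 8v is kept; the others are at most 1/2 since v <= 1/16. *)
rewrite -(prednK k0) !exprS.
have -> : 16 * v * (2^-1 * 2^-1 ^+ k.-1) = 8 * v * 2^-1 ^+ k.-1 by field.
by rewrite ler_wpM2l ?mulr_ge0 //; apply: lerXn2r; rewrite ?nnegrE; lra.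
Qed.

Lemma sum_half_powers (m : nat) : \sum_(k < m) 2^-1 ^+ k.+1 <= 1 :> R.
Proof.
suff -> : \sum_(k < m) 2^-1 ^+ k.+1 = 1 - 2^-1 ^+ m :> R by rewrite gerBl exprn_ge0 // invr_ge0.
elim: m => [|m IH]; first by rewrite big_ord0 expr0 subrr.
by rewrite big_ord_recr /= IH !exprS; field.
Qed.

End HyperedgeSum.

Section TotalAdvantage.
Context {R : realFieldType} {V E J : finType} (pos : E * J -> V).
Hypothesis pos_inj : injective pos.

(** The level inequality and C(n, j) >= (n / j)^j bound the term of a set of k hyperedges by |A|^2
    ((2tk + 4c) / n)^(kt); summed over the sets of size k, these decay geometrically in k. *)
Lemma advantage_le (A : {set {set V}}) (G : {perm V} -> {set E} -> bool)
    (c : nat) (v eps : R) :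
  (1 < #|J|)%N -> (0 < #|E|)%N -> #|V| = (64 * #|J| * #|E|)%N ->
  0 <= v -> v <= 16^-1 -> c%:R ^+ #|J| <= v * #|E|%:R ^+ #|J|.-1 ->
  0 <= eps -> #|E|%:R^-1 + 16 * v <= eps ^+ 2 ->
  (2 ^ #|V| <= #|A| * 2 ^ c)%N ->
  advantage (R := R) pos A G <= (#|V|)`!%:R * #|A|%:R * eps.
Proof.
move=> t1 m0 nE v0 v1 hc eps0 heps Abig.
set t := #|J| in t1 nE hc *; set m := #|E| in m0 nE hc heps *.
have small (S : {set E}) : (#|S| * #|J| <= #|V|)%N.
  rewrite nE -mulnA mulnCA [(#|S| * _)%N]mulnC leq_mul //.
  by apply: leq_trans (max_card _) (leq_pmull _ _).
have rhs0 : 0 <= (#|V|)`!%:R * #|A|%:R * eps by rewrite !mulr_ge0.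
apply: le_trans (ler_norm _) _.
rewrite -(@ler_pXn2r _ 2) ?nnegrE // real_normK ?num_real //.
apply: le_trans (advantage_sq pos_inj A G small) _.
rewrite exprMn [in leRHS]exprMn -mulrA ler_wpM2l ?exprn_ge0 //.
pose F k : R := #|A|%:R ^+ 2 * ((2 * t * k + 4 * c)%:R / (64 * t * m)%:R) ^+ (k * t).
apply: (@le_trans _ _ (\sum_(S : {set E} | S != set0) F #|S|)).
  apply: ler_sum => S S0; rewrite -/t.
  set k := #|S|; have k0 : (0 < k)%N by rewrite card_gt0.
  have km : (k <= m)%N by exact: max_card.
  have j0 : (0 < k * t)%N by rewrite muln_gt0 k0 ltnW.
  have jn : (k * t <= #|V|)%N by rewrite /k small.
  have jR : 0 < (k * t)%:R :> R by rewrite ltr0n.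
  have nR : 0 < #|V|%:R :> R by rewrite ltr0n; apply: leq_trans jn.
  rewrite ler_pdivrMr ?ltr0n ?bin_gt0 //.
  (* The exponent depends on the level: c <= ktr, while 2(2r - 1) stays at most (2tk + 4c) /
     (kt). *)
  pose r := (c %/ (k * t)).+1.
  have cr : (c <= k * t * r)%N by rewrite /r ltnW // mulnC -ltn_divLR.
  apply: le_trans (level_weight_le (isT : (0 < r)%N) cr Abig) _.
  rewrite /F -[leRHS]mulrA ler_wpM2l ?exprn_ge0 //.
  apply: (@le_trans _ _ (((2 * t * k + 4 * c)%:R / (k * t)%:R) ^+ (k * t))).
    apply: lerXn2r; rewrite ?nnegrE ?divr_ge0 //.
    rewrite ler_pdivlMr // -natrM ler_nat /r.
    have := leq_divM c (k * t); rewrite -[(2 * t * k)%N]mulnA [(t * k)%N]mulnC.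
    by move: (k * t)%N (c %/ (k * t))%N => a d; clear; nia.
  rewrite !expr_div_n -/t -nE -mulrA ler_wpM2l ?exprn_ge0 //.
  rewrite ler_pdivlMl ?exprn_gt0 // ler_pdivrMr ?exprn_gt0 //.
  by rewrite -!(natrX, natrM) ler_nat bin_lower_bound.
rewrite sum_nonempty_sets -/m.
apply: (@le_trans _ _ (\sum_(k < m) #|A|%:R ^+ 2 * ((m%:R^-1 + 16 * v) * 2^-1 ^+ k.+1))).
  apply: ler_sum => k _; rewrite /F mulrCA ler_wpM2l ?exprn_ge0 //.
  by apply: hyperedge_term_le => //=; exact: ltn_ord.
rewrite -!mulr_sumr ler_wpM2l ?exprn_ge0 //.
apply: le_trans heps; rewrite -[leRHS]mulr1 ler_wpM2l ?sum_half_powers //.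
by rewrite addr_ge0 ?invr_ge0 ?mulr_ge0.
Qed.

Lemma advantage_le_card (A : {set {set V}}) (G : {perm V} -> {set E} -> bool) :
  advantage (R := R) pos A G <= (#|V|)`!%:R * #|A|%:R.
Proof.
rewrite /advantage -card_perm_type mulr_natl -sumr_const; apply: ler_sum => s _.
rewrite -sumr_const; apply: ler_sum => x _.
by case: (G s _); case: (G s _); rewrite /=; lra.
Qed.

(* Memory states with few preimages are rare and contribute the second term. *)
Lemma total_advantage_le (Mem : finType) (tau : {set V} -> Mem)
    (G : Mem -> {perm V} -> {set E} -> bool) (c : nat) (v eps : R) :
  (1 < #|J|)%N -> (0 < #|E|)%N -> #|V| = (64 * #|J| * #|E|)%N ->
  0 <= v -> v <= 16^-1 -> c%:R ^+ #|J| <= v * #|E|%:R ^+ #|J|.-1 ->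
  0 <= eps -> #|E|%:R^-1 + 16 * v <= eps ^+ 2 ->
  \sum_(x : {set V}) \sum_(s : {perm V})
    ((G (tau x) s (parities pos s x))%:R - (G (tau x) s (~: parities pos s x))%:R)
  <= (#|V|)`!%:R * 2 ^+ #|V| * (eps + #|Mem|%:R / 2 ^+ c) :> R.
Proof.
move=> t1 m0 nE v0 v1 hc eps0 heps.
rewrite (partition_big tau xpredT) //=.
pose A mu := [set x | tau x == mu].
have -> : \sum_mu \sum_(x | tau x == mu) \sum_(s : {perm V})
    ((G (tau x) s (parities pos s x))%:R - (G (tau x) s (~: parities pos s x))%:R)
   = \sum_mu advantage (R := R) pos (A mu) (G mu).
  apply: eq_bigr => mu _; rewrite exchange_big /=; apply: eq_bigr => s _.
  by apply: eq_big => [x|x /eqP ->] //; rewrite inE.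
have sumA : \sum_mu #|A mu|%:R = 2 ^+ #|V| :> R.
  rewrite -natrX -card_set_type -sum1_card (partition_big tau xpredT) //= natr_sum.
  by apply: eq_bigr => mu _; rewrite -sum1_card; congr (_%:R); apply: eq_bigl => x; rewrite inE.
apply: (@le_trans _ _ (\sum_mu ((#|V|)`!%:R * #|A mu|%:R * eps + (#|V|)`!%:R * (2 ^+ #|V| / 2 ^+ c)))).
  apply: ler_sum => mu _; have [big|small] := leqP (2 ^ #|V|) (#|A mu| * 2 ^ c).
    apply: le_trans (advantage_le _ t1 m0 nE v0 v1 hc eps0 heps big) _.
    by rewrite lerDl !mulr_ge0 ?invr_ge0 ?exprn_ge0.
  apply: le_trans (advantage_le_card _ _) _.
  rewrite ler_wpDl ?mulr_ge0 // ler_wpM2l // ler_pdivlMr ?exprn_gt0 //.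
  by rewrite -!(natrX, natrM) ler_nat ltnW.
rewrite big_split /= -mulr_suml -mulr_sumr sumA sumr_const -[_ *+ #|Mem|]mulr_natl.
by rewrite le_eqVlt; apply/orP; left; apply/eqP; field; rewrite expf_neq0 ?pnatr_eq0.
Qed.

End TotalAdvantage.

(** * Singular values of the gadgets *)

(** The Weinstein-Aronszajn identity, from two triangular factorisations of the block matrix with
    rows (1, A) and (B, 1). *)
Lemma det_1_sub_mulmx_comm (F : comUnitRingType) (m n : nat)
    (A : 'M[F]_(m, n)) (B : 'M[F]_(n, m)) :
  \det (1%:M - A *m B) = \det (1%:M - B *m A).
Proof.
pose M := block_mx 1%:M A B 1%:M.
have E1 : \det M = \det (1%:M - B *m A).
  have -> : M = block_mx 1%:M 0 B 1%:M *m block_mx 1%:M A 0 (1%:M - B *m A).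
    rewrite mulmx_block ?mul1mx ?mul0mx ?mulmx1 ?mulmx0 ?addr0.
    by rewrite /M addrCA subrr addr0.
  by rewrite det_mulmx det_lblock det_ublock !det1 !mul1r.
have E2 : \det M = \det (1%:M - A *m B).
  have -> : M = block_mx (1%:M - A *m B) A 0 1%:M *m block_mx 1%:M 0 B 1%:M.
    rewrite mulmx_block ?mul1mx ?mul0mx ?mulmx1 ?mulmx0 ?add0r.
    by rewrite /M subrK.
  by rewrite det_mulmx det_lblock det_ublock !det1 !mulr1.
by rewrite -E1 E2.
Qed.

Lemma horner_char_poly (F : comNzRingType) (n : nat) (A : 'M[F]_n) (a : F) :
  (char_poly A).[a] = \det (a%:M - A).
Proof.
rewrite /char_poly -horner_evalE -det_map_mx; congr (\det _).
apply/matrixP => i j; rewrite !mxE /= horner_evalE hornerD hornerN hornerMn hornerX hornerC.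
by [].
Qed.

(** [(p - q) * w] vanishes at all naturals, hence is zero. *)
Lemma poly_eq_of_horner (R : numDomainType) (p q w : {poly R}) : w != 0 ->
  (forall a, w.[a] != 0 -> p.[a] = q.[a]) -> p = q.
Proof.
move=> w0 pq; apply/eqP; rewrite -subr_eq0.
have : (p - q) * w == 0.
  set f := _ * w; apply: contraT => f0.
  pose rs : seq R := [seq n%:R | n <- iota 0 (size f)].
  suff: (size rs < size f)%N by rewrite size_map size_iota ltnn.
  apply: max_poly_roots f0 _ _.
    apply/allP => a _; rewrite /root /f hornerM hornerD hornerN.
    by have [->|/pq ->] := eqVneq w.[a] 0; rewrite ?mulr0 // subrr mul0r.
  by rewrite map_inj_uniq ?iota_uniq // => i j /eqP; rewrite eqr_nat => /eqP.
by rewrite mulf_eq0 (negPf w0) orbF.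
Qed.

Section GadgetSpectrum.
Context {R : numFieldType} (N g : nat) (J : finType) (b : 'I_N -> bool).
Variable u : 'I_g * J -> 'I_N.
Hypothesis u_inj : injective u.

Definition gadget_mx : 'M[R]_(N, g) := \matrix_(c, i) [exists j, u (i, j) == c]%:R.

Definition gadget_gram : 'M[R]_N :=
  diag_mx (\row_c (b c)%:R) + gadget_mx *m gadget_mx^T.

Definition gadget_ones (i : 'I_g) : nat := #|[set j | b (u (i, j))]|.

(** Take out the diagonal part and apply the Weinstein-Aronszajn identity: the remaining g x g
    matrix is diagonal because the supports of the gadgets are disjoint. The factor (a (a - 1))^g
    clears its denominators. *)
Lemma gadget_det (a : R) : a != 0 -> a != 1 ->
  \det (a%:M - gadget_gram) * (a * (a - 1)) ^+ g =
  \prod_c (a - (b c)%:R) *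
  \prod_i (a ^+ 2 - (1 + #|J|%:R) * a + (#|J|%:R - (gadget_ones i)%:R)).
Proof.
move=> a0 a1.
have ab (c : bool) : a - c%:R != 0 by rewrite subr_eq0; case: c.
pose L : 'rV[R]_N := \row_c (a - (b c)%:R).
pose L' : 'rV[R]_N := \row_c (a - (b c)%:R)^-1.
have LL : diag_mx L *m diag_mx L' = 1%:M.
  rewrite mulmx_diag -(scalemx1 _ (1 : R)) scale1r; apply/matrixP => i j; rewrite !mxE.
  by rewrite divff.
have -> : a%:M - gadget_gram =
    diag_mx L *m (1%:M - (diag_mx L' *m gadget_mx) *m gadget_mx^T).
  rewrite mulmxBr mulmx1 !mulmxA LL mul1mx /gadget_gram opprD addrA; congr (_ - _).
  by apply/matrixP => i j; rewrite !mxE -mulrnBl.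
rewrite det_mulmx det_diag det_1_sub_mulmx_comm -mulrA; congr (_ * _).
  by apply: eq_bigr => c _; rewrite mxE.
have -> : 1%:M - gadget_mx^T *m (diag_mx L' *m gadget_mx)
    = diag_mx (\row_i (1 - \sum_j (a - (b (u (i, j)))%:R)^-1)).
  apply/matrixP => i i'; rewrite !mxE.
  have -> : \sum_c gadget_mx^T i c * (diag_mx L' *m gadget_mx) c i' =
      (i == i')%:R * \sum_j (a - (b (u (i, j)))%:R)^-1.
    transitivity (\sum_c \sum_(j | u (i, j) == c) (i == i')%:R * (a - (b c)%:R)^-1).
      apply: eq_bigr => c _; rewrite mul_diag_mx !mxE.
      have [/existsP[j /eqP jc]|/existsPn nc] := boolP [exists j, u (i, j) == c]; last first.
        by rewrite mul0r big_pred0 // => j; apply/negbTE.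
      rewrite mul1r (big_pred1 j); last first.
        by move=> j'; rewrite -jc (inj_eq u_inj) xpair_eqE eqxx.
      rewrite mulrC; congr ((nat_of_bool _)%:R * _); apply/existsP/eqP => [[j' /eqP]|<-].
        by rewrite -jc => /u_inj[].
      by exists j; apply/eqP.
    rewrite mulr_sumr [RHS](partition_big (fun j => u (i, j)) xpredT) //=.
    by apply: eq_bigr => c _; apply: eq_bigr => j /eqP ->.
  by case: eqP => _; rewrite ?mul1r ?mul0r ?subr0 ?mulr1n ?mulr0n.
rewrite det_diag -[X in _ ^+ X]card_ord -prodr_const -big_split /=.
apply: eq_bigr => i _; rewrite mxE /gadget_ones.
have -> : \sum_j (a - (b (u (i, j)))%:R)^-1 =
    #|[set j | b (u (i, j))]|%:R / (a - 1) + (#|J|%:R - #|[set j | b (u (i, j))]|%:R) / a.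
  rewrite (bigID (fun j => b (u (i, j)))) /=; congr (_ + _).
    rewrite (eq_bigr (fun=> (a - 1)^-1)) => [|j ->] //.
    by rewrite sumr_const mulr_natl cardsE.
  rewrite (eq_bigr (fun=> a^-1)) => [|j /negPf ->]; last by rewrite subr0.
  rewrite sumr_const -[_ *+ _]mulr_natl; congr (_ / _).
  rewrite -(cardC (fun j => b (u (i, j)))) natrD cardsE addrAC subrr add0r.
  by congr (_%:R); apply: eq_card.
by field; rewrite a0 subr_eq0 a1.
Qed.

Lemma gadget_char_poly :
  char_poly gadget_gram * ('X * ('X - 1%:P)) ^+ g =
  \prod_c ('X - (b c)%:R%:P) *
  \prod_i ('X ^+ 2 - (1 + #|J|%:R)%:P * 'X + (#|J|%:R - (gadget_ones i)%:R)%:P).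
Proof.
apply: (@poly_eq_of_horner R _ _ ('X * ('X - 1%:P))).
  by rewrite mulf_neq0 ?polyX_eq0 ?polyXsubC_eq0.
move=> a; rewrite !hornerE mulf_eq0 negb_or subr_eq0 => /andP[a0 a1].
rewrite horner_char_poly gadget_det // !horner_prod; congr (_ * _).
  by apply: eq_bigr => c _; rewrite !hornerE.
by apply: eq_bigr => i _; rewrite !hornerE.
Qed.

End GadgetSpectrum.

Require Import Defs.
From mathcomp Require Import reals exp.

Section SchattenCharPoly.
Context {R : realType}.

(** The share of two Gram eigenvalues m + r and m - r in the power sum, with q = p / 2. *)
Definition sym_pow (m q r : R) : R := (m + r) `^ q + (m - r) `^ q.

(* Allowing a cofactor on the left avoids dividing characteristic polynomials. *)
Lemma schatten_pow_char_poly (N : nat) (X : 'M[R]_N) (p : R) (s1 s2 : seq R) :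
  char_poly (X^T *m X) * \prod_(y <- s1) ('X - y%:P) = \prod_(y <- s2) ('X - y%:P) ->
  schatten_pow p X + \sum_(y <- s1) y `^ (p / 2) = \sum_(y <- s2) y `^ (p / 2).
Proof.
have /and3P[_ /allP s0 /eqP ->] := singular_valuesP X.
rewrite -(big_map (fun x => x ^+ 2) xpredT (fun y => 'X - y%:P)) -big_cat => /prod_XsubC_eq E.
rewrite -(perm_big _ E) /= big_cat big_map /schatten_pow; congr (_ + _).
rewrite big_seq [RHS]big_seq; apply: eq_bigr => x /s0 x0.
by rewrite -powR_mulrn // -powRrM mulrCA divff ?mulr1 // pnatr_eq0.
Qed.

Lemma quadratic_split (t k : nat) : (0 < t)%N ->
  let r := Num.sqrt (((t%:R - 1) / 2) ^+ 2 + k%:R) in let m := (1 + t%:R) / 2 in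
  'X ^+ 2 - (1 + t%:R)%:P * 'X + (t%:R - k%:R)%:P
  = ('X - (m + r)%:P) * ('X - (m - r)%:P) :> {poly R}.
Proof.
move=> t0 r m.
have rr : r ^+ 2 = ((t%:R - 1) / 2) ^+ 2 + k%:R.
  by rewrite sqr_sqrtr // addr_ge0 ?sqr_ge0.
have sumE : (1 + t%:R)%:P = (m + r)%:P + (m - r)%:P :> {poly R}.
  by rewrite -polyCD; congr (_%:P); rewrite /m; field.
have prodE : (t%:R - k%:R)%:P = (m + r)%:P * (m - r)%:P :> {poly R}.
  rewrite -polyCM; congr (_%:P).
  transitivity (m ^+ 2 - r ^+ 2); last by ring.
  by rewrite rr /m; field.
by rewrite sumE prodE; ring.
Qed.

Lemma schatten_pow_gadget (N g : nat) (J : finType) (b : 'I_N -> bool)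
    (u : 'I_g * J -> 'I_N) (X : 'M[R]_N) (p : R) :
  injective u -> (0 < #|J|)%N -> 0 < p -> X^T *m X = gadget_gram b u ->
  schatten_pow p X = (\sum_c b c)%:R +
    \sum_i (sym_pow ((1 + #|J|%:R) / 2) (p / 2)
       (Num.sqrt (((#|J|%:R - 1) / 2) ^+ 2 + (gadget_ones b u i)%:R)) - 1).
Proof.
move=> u_inj t0 p0 XE.
set m := (1 + _) / 2; pose r i : R := Num.sqrt (((#|J|%:R - 1) / 2) ^+ 2 + (gadget_ones b u i)%:R).
(* The roots of the cofactor: the zeros contribute nothing, the ones account for the [- 1] per
   gadget. *)
pose s1 : seq R := nseq g 0 ++ nseq g 1.
pose s2 : seq R := [seq (b c)%:R | c <- index_enum 'I_N]
  ++ ([seq m + r i | i <- index_enum 'I_g] ++ [seq m - r i | i <- index_enum 'I_g]).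
have := @schatten_pow_char_poly N X p s1 s2.
rewrite XE /s1 /s2 !big_cat !big_nseq !big_map /=.
have E : char_poly (gadget_gram b u) * (iter g ( *%R ('X - 0%:P)) 1 * iter g ( *%R ('X - 1%:P)) 1) =
    \prod_i ('X - (b i)%:R%:P) * (\prod_i ('X - (m + r i)%:P) * \prod_i ('X - (m - r i)%:P)).
  rewrite !iter_mulr_1 -exprMn subr0 gadget_char_poly // -big_split /=; congr (_ * _).
  by apply: eq_bigr => i _; rewrite quadratic_split.
move=> /(_ E).
have p2 : p / 2 != 0 by rewrite gt_eqF // divr_gt0.
rewrite powR0 // powR1 !iter_addr_0 mul0rn add0r.
have -> : \sum_i (b i)%:R `^ (p / 2) = (\sum_c b c)%:R :> R.
  by rewrite natr_sum; apply: eq_bigr => i _; case: (b i); rewrite /= ?powR1 ?powR0.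
rewrite -big_split /= => H.
rewrite sumrB sumr_const card_ord addrA -H addrK.
by [].
Qed.

End SchattenCharPoly.

(** * The stream of an instance and its Gram matrix *)

Section UnitStream.
Context {R : realType} {N : nat}.

Definition unit_stream (l : seq ('I_N * 'I_N)) : seq (update (R := R) N) :=
  [seq (ij, 1) | ij <- l].

Lemma stream_matrix_cat (s1 s2 : seq (update (R := R) N)) :
  stream_matrix (s1 ++ s2) = stream_matrix s1 + stream_matrix s2.
Proof. by rewrite /stream_matrix big_cat. Qed.

Lemma unit_streamE (l : seq ('I_N * 'I_N)) i j : uniq l ->
  stream_matrix (unit_stream l) i j = ((i, j) \in l)%:R.
Proof.
elim: l => [_|[a c] l IH /andP[al ul]].
  by rewrite /stream_matrix big_nil mxE.
have -> : stream_matrix (unit_stream ((a, c) :: l)) = delta_mx a c + stream_matrix (unit_stream l).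
  by rewrite /stream_matrix /= big_cons scale1r.
rewrite mxE IH // mxE inE xpair_eqE.
by case: andP => [[/eqP -> /eqP ->]|_]; rewrite ?(negPf al) ?addr0 ?add0r.
Qed.

(** The positions are distinct, so every prefix gives a 0/1 matrix. *)
Lemma unit_stream_over (l : seq ('I_N * 'I_N)) (D : R -> Prop) :
  uniq l -> D 0 -> D 1 -> stream_over D (unit_stream l).
Proof.
move=> ul D0 D1 k i j; rewrite /unit_stream -map_take unit_streamE ?take_uniq //.
by case: (_ \in _).
Qed.

End UnitStream.

Section Construction.
Context {R : realType} {V E J : finType} {N : nat} (pos : E * J -> V).
Hypothesis pos_inj : injective pos.
Variable iota : (V * {set J} * bool) + (E * {set J}) -> 'I_N.
Hypothesis iota_inj : injective iota.
Implicit Types (x : {set V}) (s : {perm V}) (w : {set E}).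

(* Column [inl (v, S, c)] carries the bit [(v \in x) (+) c]. The rows are indexed by the columns
   (Alice) and by all candidate gadgets [inr (e, S)] (Bob). *)
Definition alice_positions x : seq ('I_N * 'I_N) :=
  [seq (iota (inl (vS, vS.1 \notin x)), iota (inl (vS, vS.1 \notin x)))
     | vS : V * {set J} <- enum {: V * {set J}}].

Definition gadget_col s (e : E) (S : {set J}) (j : J) : 'I_N :=
  iota (inl (s (pos (e, j)), S, j \in S)).

Definition bob_positions s w : seq ('I_N * 'I_N) :=
  [seq (iota (inr eSj.1), gadget_col s eSj.1.1 eSj.1.2 eSj.2)
     | eSj : E * {set J} * J <- enum {: E * {set J} * J} & odd #|eSj.1.2| == (eSj.1.1 \in w)].

Lemma alice_positions_size x : size (alice_positions x) = (#|V| * 2 ^ #|J|)%N.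
Proof. by rewrite size_map -cardE card_prod card_set_type. Qed.

Lemma positions_uniq x s w : uniq (alice_positions x ++ bob_positions s w).
Proof.
rewrite cat_uniq; apply/and3P; split.
- rewrite map_inj_uniq ?enum_uniq // => vS vS' [].
  by move=> /iota_inj [<-].
- apply/hasPn => _ /mapP[eSj _ ->]; apply/negP => /mapP[vS _ []].
  by move=> /iota_inj.
- rewrite map_inj_in_uniq; first by apply: filter_uniq; exact: enum_uniq.
  move=> [[e S] j] [[e' S'] j'] _ _ [] /iota_inj [<- <-] /iota_inj [].
  by move=> /perm_inj /pos_inj [<-].
Qed.

Let bit x (c : 'I_N) : bool := (c, c) \in alice_positions x.

Lemma bitE x v (S : {set J}) (c : bool) : bit x (iota (inl (v, S, c))) = (c == (v \notin x)).
Proof.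
apply/mapP/eqP => [[[v' S'] _ []]|->]; first by move=> /iota_inj [-> _ ->].
by exists (v, S); rewrite ?mem_enum.
Qed.

Lemma sum_bit x : (\sum_c bit x c = #|V| * 2 ^ #|J|)%N.
Proof.
pose D := [seq ij.1 | ij <- alice_positions x].
have uD : uniq D.
  rewrite /D -map_comp map_inj_uniq ?enum_uniq // => vS vS' /=.
  by move=> /iota_inj [<-].
have DE c : bit x c = (c \in D).
  apply/idP/mapP => [cA|[[i j] ijA ->]]; first by exists (c, c).
  rewrite /bit; case/mapP: (ijA) => vS _ [iE jE] /=.
  by move: ijA; rewrite iE jE.
under eq_bigr do rewrite DE.
rewrite -(alice_positions_size x) -(size_map fst) -/D -(card_uniqP uD) -sum1_card [RHS]big_mkcond.
by apply: eq_bigr => c _; case: (c \in D).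
Qed.

Definition gadget_type w := {eS : E * {set J} | odd #|eS.2| == (eS.1 \in w)}.

Definition gadget_cols s w (ij : 'I_#|{: gadget_type w}| * J) : 'I_N :=
  let eS := val (enum_val ij.1) in gadget_col s eS.1 eS.2 ij.2.

Lemma gadget_cols_inj s w : injective (@gadget_cols s w).
Proof.
move=> [i j] [i' j']; rewrite /gadget_cols /gadget_col /= => /iota_inj [].
move=> /perm_inj /pos_inj [e1 <-] S1 _; congr (_, _); apply: enum_val_inj; apply: val_inj.
by rewrite [LHS]surjective_pairing [RHS]surjective_pairing e1 S1.
Qed.

(** Alice and Bob use different rows, so the cross terms vanish. Alice's part is a 0/1 diagonal
    matrix; Bob's is Q U^T, where the columns of Q are distinct unit vectors, so its Gram matrix is
    U U^T. *)
Lemma gram_instance x s w :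
  let X := stream_matrix (unit_stream (alice_positions x ++ bob_positions s w)) in
  X^T *m X = gadget_gram (bit x) (@gadget_cols s w) :> 'M[R]_N.
Proof.
move=> X; have /[!cat_uniq] /and3P[ua _ ub] := positions_uniq x s w.
pose A : 'M[R]_N := stream_matrix (unit_stream (alice_positions x)).
pose B : 'M[R]_N := stream_matrix (unit_stream (bob_positions s w)).
have XE : X = A + B by rewrite /X /unit_stream map_cat stream_matrix_cat.
have AE : A = diag_mx (\row_c (bit x c)%:R).
  apply/matrixP => i j; rewrite unit_streamE // !mxE.
  have [->|ij] := eqVneq i j; first by rewrite mulr1n.
  rewrite mulr0n; case: mapP => // -[vS _ [iE jE]].
  by rewrite iE jE eqxx in ij.
pose U : 'M[R]_(N, _) := gadget_mx (@gadget_cols s w).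
pose Q : 'M[R]_(N, #|{: gadget_type w}|) :=
  \matrix_(r, i) (r == iota (inr (val (enum_val i))))%:R.
have BE : B = Q *m U^T.
  apply/matrixP => r c; rewrite unit_streamE // !mxE.
  have [/mapP[[[e S] j]]|notin] := boolP ((r, c) \in bob_positions s w).
    rewrite mem_filter /= => /andP[cond _] [rE cE].
    pose y : gadget_type w := exist _ (e, S) cond.
    rewrite (bigD1 (enum_rank y)) //= !mxE enum_rankK rE eqxx mul1r.
    have -> : [exists j0, gadget_cols s (enum_rank y, j0) == c].
      by apply/existsP; exists j; rewrite /gadget_cols /= enum_rankK /= cE.
    rewrite big1 ?addr0 // => i iy; rewrite !mxE; case: eqP => [|_]; last by rewrite mul0r.
    move=> /iota_inj [] yi; case/eqP: iy; apply: enum_val_inj; apply: val_inj.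
    by rewrite enum_rankK; exact: esym yi.
  rewrite big1 // => i _; rewrite !mxE; case: eqP => [rE|_]; last by rewrite mul0r.
  case: existsP => [[j /eqP cE]|_]; last by rewrite mulr0.
  case/negP: notin; apply/mapP; exists (val (enum_val i), j) => /=.
    by rewrite mem_filter /= (valP (enum_val i)) mem_enum.
  by rewrite rE -cE.
have QQ : Q^T *m Q = 1%:M.
  apply/matrixP => i i'; rewrite !mxE (bigD1 (iota (inr (val (enum_val i))))) //= !mxE eqxx mul1r.
  rewrite big1 ?addr0 => [|r rn]; last by rewrite !mxE (negPf rn) mul0r.
  congr (nat_of_bool _)%:R; apply/eqP/eqP => [|->] //.
  by move=> /iota_inj [] /val_inj /enum_val_inj.
have AB : A^T *m B = 0.
  apply/matrixP => c c'; rewrite !mxE big1 // => r _; rewrite mxE !unit_streamE //.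
  case: mapP => [[vS _ [rE _]]|_]; last by rewrite mul0r.
  case: mapP => [[eS _ [rE' _]]|_]; last by rewrite mulr0.
  by move: rE'; rewrite rE => /iota_inj.
have BA : B^T *m A = 0 by rewrite -[A]trmxK -trmx_mul AB trmx0.
rewrite XE [(A + B)^T]raddfD /= mulmxDl !mulmxDr AB BA addr0 add0r /gadget_gram; congr (_ + _).
  rewrite AE tr_diag_mx mulmx_diag; congr diag_mx; apply/rowP => c; rewrite !mxE.
  by case: (bit x c); rewrite ?mulr1 ?mulr0.
by rewrite BE trmx_mul trmxK mulmxA -(mulmxA U) QQ mulmx1.
Qed.

End Construction.

Definition symdiff (T : finType) (A B : {set T}) : {set T} :=
  [set j | (j \in A) (+) (j \in B)].

Lemma symdiffK (T : finType) (B : {set T}) : involutive (fun A => symdiff A B).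
Proof. by move=> A; apply/setP => j; rewrite !inE -addbA addbb addbF. Qed.

Lemma odd_card_symdiff (T : finType) (A B : {set T}) :
  odd #|symdiff A B| = odd #|A| (+) odd #|B|.
Proof.
have cardE (C : {set T}) : #|C| = (\sum_(j : T) (j \in C))%N.
  by rewrite -sum1_card big_mkcond; apply: eq_bigr => j _; case: (j \in C).
have -> : odd #|symdiff A B| = odd (#|symdiff A B| + 2 * #|A :&: B|).
  by rewrite oddD oddM addbF.
suff -> : (#|symdiff A B| + 2 * #|A :&: B| = #|A| + #|B|)%N by rewrite oddD.
rewrite !cardE big_distrr /= -!big_split /=; apply: eq_bigr => j _.
by rewrite !inE; case: (j \in A); case: (j \in B).
Qed.

Section SchattenStream.
Context {R : realType} {V E J : finType} {N : nat} (pos : E * J -> V).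
Hypothesis pos_inj : injective pos.
Variable iota : (V * {set J} * bool) + (E * {set J}) -> 'I_N.
Hypothesis iota_inj : injective iota.
Implicit Types (x : {set V}) (s : {perm V}) (w : {set E}).

Definition bob_input s x (b : bool) : {set E} :=
  if b then ~: parities pos s x else parities pos s x.

(** Gadget (e, S) has |[symdiff S (xs e)]| ones. Bob admits exactly those S for which this set has
    parity [b], and the shift by [xs e] is a bijection, so all hyperedges contribute equally. *)
Lemma sum_gadgets (h : nat -> R) x s (b : bool) :
  \sum_i h (gadget_ones (fun c => (c, c) \in alice_positions iota x)
      (@gadget_cols _ _ _ _ pos iota s (bob_input s x b)) i)
  = #|E|%:R * \sum_(y : {set J} | odd #|y| == b) h #|y|.
Proof.
pose xs e : {set J} := [set j | s (pos (e, j)) \in x].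
pose w := bob_input s x b.
have wE e : (e \in w) = odd #|xs e| (+) b.
  by rewrite /w /bob_input; case: (b); rewrite !inE /xs ?addbT ?addbF.
pose F (eS : E * {set J}) := h #|symdiff eS.2 (xs eS.1)|.
transitivity (\sum_(y : gadget_type w) F (val y)).
  rewrite (reindex (@enum_val _ (mem {: gadget_type w}))) /=; last first.
    by exists enum_rank => y _; [exact: enum_valK | exact: enum_rankK].
  apply: eq_bigr => i _; rewrite /F /gadget_ones; congr h.
  apply: eq_card => j; rewrite !inE /gadget_cols /gadget_col /= bitE // ?inE.
  by case: (_ \in _); case: (_ \in _).
transitivity (\sum_(eS : E * {set J} | odd #|eS.2| == (eS.1 \in w)) F eS).
  rewrite [RHS](reindex_omap (val : gadget_type w -> _) insub) /=; last first.
    by move=> eS H; rewrite insubT.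
  by apply: eq_bigl => y; rewrite valK eqxx andbT; apply/esym; exact: (valP y).
rewrite -(pair_big_dep xpredT (fun e (S : {set J}) => odd #|S| == (e \in w)) (fun e S => F (e, S))) /=.
have -> : #|E|%:R * \sum_(y : {set J} | odd #|y| == b) h #|y|
    = \sum_(e : E) \sum_(y : {set J} | odd #|y| == b) h #|y| by rewrite sumr_const mulr_natl.
apply: eq_bigr => e _.
rewrite (reindex_inj (inv_inj (@symdiffK J (xs e)))) /=.
apply: eq_big => [S|S _]; last by rewrite /F /= symdiffK.
rewrite odd_card_symdiff wE.
by case: (odd #|S|); case: (odd #|xs e|); case: (b).
Qed.

Definition instance_stream x s (b : bool) : seq (update (R := R) N) :=
  unit_stream (alice_positions iota x) ++ unit_stream (bob_positions pos iota s (bob_input s x b)).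

Definition gadget_power (p : R) (k : nat) : R :=
  sym_pow ((1 + #|J|%:R) / 2) (p / 2) (Num.sqrt (((#|J|%:R - 1) / 2) ^+ 2 + k%:R)).

(** Neither [x] nor [s] survives on the right: the norm is a function of the hidden bit alone. *)
Lemma schatten_pow_instance (p : R) x s (b : bool) : (0 < #|J|)%N -> 0 < p ->
  schatten_pow p (stream_matrix (instance_stream x s b)) =
  (#|V| * 2 ^ #|J|)%:R + #|E|%:R * \sum_(y : {set J} | odd #|y| == b) (gadget_power p #|y| - 1).
Proof.
move=> J0 p0; rewrite /instance_stream /unit_stream -map_cat.
have cols_inj := @gadget_cols_inj _ _ _ _ _ pos_inj _ iota_inj s (bob_input s x b).
rewrite (schatten_pow_gadget cols_inj J0 p0 (gram_instance pos_inj iota_inj _ _ _)).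
by rewrite sum_bit // (sum_gadgets (fun k => gadget_power p k - 1)).
Qed.

Lemma instance_stream_over (D : R -> Prop) x s b : D 0 -> D 1 ->
  stream_over D (instance_stream x s b).
Proof.
move=> D0 D1; rewrite /instance_stream /unit_stream -map_cat.
by apply: unit_stream_over => //; exact: positions_uniq.
Qed.

End SchattenStream.

From mathcomp Require Import all_classical all_reals all_analysis measurable_realfun.
Import numFieldNormedType.Exports.

(** * Separation of the two Schatten norms *)

(** Pascal's rule turns this t-th finite difference of P into the previous one of P(X) - P(X + 1),
    where the leading terms cancel. *)
Lemma alternating_sum_poly (R : idomainType) (t : nat) (P : {poly R}) (d : R) :
  (size P <= t)%N ->
  \sum_(k < t.+1) (-1) ^+ k * 'C(t, k)%:R * P.[d + k%:R] = 0.
Proof.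
elim: t P => [|t IH] P.
  by rewrite leqn0 size_poly_eq0 => /eqP ->; rewrite big1 // => i _; rewrite horner0 mulr0.
move=> szP; pose Q := P - (P \Po ('X + 1%:P)).
have szQ : (size Q <= t)%N.
  have szX : size ('X + 1%:P : {poly R}) = 2 by rewrite size_XaddC.
  have [P0|P0] := eqVneq P 0.
    by rewrite /Q P0 comp_poly0 subrr size_poly0.
  have szc : size (P \Po ('X + 1%:P)) = size P by rewrite size_comp_poly2.
  have szQ : (size Q <= size P)%N.
    by apply: leq_trans (size_polyD _ _) _; rewrite size_polyN szc maxnn.
  rewrite -ltnS; apply: leq_trans szP; rewrite -(ltn_predK (_ : 0 < size P)%N) ?size_poly_gt0 //.
  rewrite ltnS; apply/leq_sizeP => j; rewrite leq_eqVlt => /orP[/eqP <-|Pj].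
    rewrite coefB -lead_coefE -szc -lead_coefE.
    rewrite lead_coef_comp ?szX // lead_coefDl ?size_polyX ?size_polyC ?oner_neq0 //.
    by rewrite lead_coefX expr1n mulr1 subrr.
  by apply: nth_default; apply: leq_trans szQ _; rewrite -(ltn_predK (_ : 0 < size P)%N) ?size_poly_gt0.
rewrite -[RHS](IH Q szQ).
transitivity (\sum_(k < t.+1) (-1) ^+ k * 'C(t, k)%:R * P.[d + k%:R]
   - \sum_(k < t.+1) (-1) ^+ k * 'C(t, k)%:R * P.[d + k.+1%:R]); last first.
  rewrite -sumrB; apply: eq_bigr => k _.
  by rewrite /Q hornerD hornerN horner_comp !hornerE -natr1 addrA mulrBr.
rewrite big_ord_recl [X in _ = X - _]big_ord_recl /= !bin0 -addrA; congr (_ + _).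
have -> : \sum_(k < t) (-1) ^+ k.+1 * 'C(t, k.+1)%:R * P.[d + k.+1%:R] =
    \sum_(k < t.+1) (-1) ^+ k.+1 * 'C(t, k.+1)%:R * P.[d + k.+1%:R].
  by rewrite big_ord_recr /= bin_small // mulr0 mul0r addr0.
rewrite -sumrB; apply: eq_bigr => k _; rewrite binS natrD exprS.
by move: P.[_] => y; ring.
Qed.

Section IteratedRolle.
Local Open Scope classical_set_scope.
Local Open Scope ring_scope.
Context {R : realType}.

Lemma le_of_lt_succ (z : nat -> R) (n : nat) :
  (forall i, (i < n)%N -> z i < z i.+1) ->
  forall i j, (i <= j <= n)%N -> z i <= z j.
Proof.
move=> mono i; elim=> [|j IH] /andP[ij jn]; first by move: ij; rewrite leqn0 => /eqP ->.
move: ij; rewrite leq_eqVlt => /orP[/eqP ->//|]; rewrite ltnS => ij.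
by apply: le_trans (IH _) (ltW (mono j jn)); rewrite ij ltnW.
Qed.

Lemma continuous_of_is_derive (g : R -> R) (x dg : R) :
  is_derive x 1 g dg -> g y @[y --> x] --> g x.
Proof.
by move=> H; apply: differentiable_continuous; apply/derivable1_diffP; exact: ex_derive.
Qed.

(** Rolle between consecutive zeros. Only left continuity is asked at [z n], which may be the
    endpoint [b], where [g] need not be differentiable. *)
Lemma rolle_zeros (g g' : R -> R) (a b : R) (z : nat -> R) (n : nat) :
  (forall x, a < x < b -> is_derive x 1 g (g' x)) ->
  g x @[x --> (z n)^'-] --> g (z n) ->
  (forall i, (i < n)%N -> z i < z i.+1) -> a < z 0%N -> z n <= b ->
  (forall i, (i <= n)%N -> g (z i) = 0) ->
  exists w : nat -> R, forall i, (i < n)%N -> z i < w i < z i.+1 /\ g' (w i) = 0.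
Proof.
move=> dg gr mono az zb zer.
have mono_le := le_of_lt_succ mono.
have step i : exists w, (i < n)%N -> z i < w < z i.+1 /\ g' w = 0.
  have [iln|] := ltnP i n; last by exists 0.
  have azi : a < z i by apply: lt_le_trans az (mono_le _ _ _); rewrite /= ltnW.
  have zin : z i.+1 <= z n by apply: mono_le; rewrite iln /=.
  have inner x : z i < x < z i.+1 -> a < x < b.
    by move=> /andP[zx xz]; rewrite (lt_trans azi zx) (lt_le_trans xz (le_trans zin zb)).
  have [||/=|w wi dw] := @Rolle R g (z i) (z i.+1) (mono i iln).
  - by move=> x; rewrite in_itv /= => /inner /dg H; exact: ex_derive.
  - apply/(continuous_within_itvP _ (mono i iln)); split.
    + by move=> x; rewrite in_itv /= => /inner /dg /continuous_of_is_derive.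
    + apply: cvg_at_right_filter; apply: continuous_of_is_derive; apply: dg.
      by rewrite azi (lt_le_trans (mono i iln) (le_trans zin zb)).
    + move: zin; rewrite le_eqVlt => /orP[/eqP -> //|zin].
      apply: cvg_at_left_filter; apply: continuous_of_is_derive; apply: dg.
      by rewrite (lt_trans azi (mono i iln)) (lt_le_trans zin zb).
  - by rewrite !zer // ltnW.
  - exists w => _; move: wi; rewrite in_itv /= => wi; split=> //.
    have [_ <-] := dw; have [_ <-] := dg _ (inner _ wi).
    by [].
by have [w H] := choice step; exists w.
Qed.

(** Each derivative loses one zero; after the first step the zeros lie strictly inside, where
    differentiability gives continuity. *)
Lemma iterated_rolle (G : nat -> R -> R) (a b : R) (z : nat -> R) (n : nat) :
  (forall i x, a < x < b -> is_derive x 1 (G i) (G i.+1 x)) ->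
  G 0%N x @[x --> (z n.+1)^'-] --> G 0%N (z n.+1) ->
  (forall i, (i < n.+1)%N -> z i < z i.+1) -> a < z 0%N -> z n.+1 <= b ->
  (forall i, (i <= n.+1)%N -> G 0%N (z i) = 0) ->
  exists2 x, a < x < b & G n.+1 x = 0.
Proof.
elim: n G z => [|n IH] G z dG cz mono az zb zer.
  have [w /(_ 0%N isT)[/andP[zw wz] Gw]] := rolle_zeros (dG 0%N) cz mono az zb zer.
  by exists (w 0%N) => //; rewrite (lt_trans az zw) (lt_le_trans wz zb).
have [w H] := rolle_zeros (dG 0%N) cz mono az zb zer.
have aw : a < w 0%N by have [/andP[zw _] _] := H 0%N isT; exact: lt_trans az zw.
have wb : w n.+1 < b by have [/andP[_ wz] _] := H n.+1 (leqnn _); exact: lt_le_trans wz zb.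
have wmono i : (i < n.+1)%N -> w i < w i.+1.
  move=> i_n; have [/andP[_ w1] _] := H i (ltnW i_n); have [/andP[w2 _] _] := H i.+1 i_n.
  exact: lt_trans w1 w2.
apply: (IH (fun i => G i.+1) w _ _ wmono aw (ltW wb))  => [|i i_n].
- apply: cvg_at_left_filter; apply: continuous_of_is_derive; apply: dG.
  by rewrite wb andbT; apply: lt_le_trans aw (le_of_lt_succ wmono _); rewrite leqnn.
- by have [] := H i i_n.
Qed.

End IteratedRolle.

Section Nonvanishing.
Local Open Scope classical_set_scope.
Local Open Scope ring_scope.
Context {R : realType}.

Lemma sym_powN (m q r : R) : sym_pow m q (- r) = sym_pow m q r.
Proof. by rewrite /sym_pow opprK addrC. Qed.

(** On (-m, m) this is the i-th derivative of [sym_pow m q r - P.[r]] in [r]. *)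
Definition sym_pow_diff (m q : R) (P : {poly R}) (i : nat) (r : R) : R :=
  \prod_(j < i) (q - j%:R) * ((m + r) `^ (q - i%:R) + (-1) ^+ i * (m - r) `^ (q - i%:R))
  - P^`(i).[r].

Lemma is_derive_sym_pow_diff (m q : R) (P : {poly R}) (i : nat) (x : R) : - m < x < m ->
  is_derive x 1 (sym_pow_diff m q P i) (sym_pow_diff m q P i.+1 x).
Proof.
move=> /andP[mx xm].
have mx0 : 0 < m + x by lra.
have xm0 : 0 < m - x by lra.
have d1 : is_derive x 1 (fun r => (m + r) `^ (q - i%:R)) ((q - i%:R) * (m + x) `^ (q - i.+1%:R)).
  have := @is_derive1_comp R (fun y => y `^ (q - i%:R)) (fun r => m + r) x _ _
     (is_derive1_powR (q - i%:R) mx0) (is_deriveD (is_derive_cst m x 1) (is_derive_id x 1)).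
  by rewrite add0r mulr1 -natr1 opprD addrA.
have d2 : is_derive x 1 (fun r => (m - r) `^ (q - i%:R)) (- ((q - i%:R) * (m - x) `^ (q - i.+1%:R))).
  have := @is_derive1_comp R (fun y => y `^ (q - i%:R)) (fun r => m - r) x _ _
     (is_derive1_powR (q - i%:R) xm0) (is_deriveB (is_derive_cst m x 1) (is_derive_id x 1)).
  by rewrite sub0r mulrN1 -natr1 opprD addrA.
pose c := \prod_(j < i) (q - j%:R).
have dp : is_derive x 1 (horner (P^`(i))) (P^`(i.+1)).[x] by rewrite derivnS; exact: is_derive_poly.
have D := is_deriveB (is_deriveZ c (is_deriveD d1 (is_deriveZ ((-1) ^+ i) d2))) dp.
apply: (is_derive_eq (f := sym_pow_diff m q P i) D).
rewrite /sym_pow_diff big_ord_recr /= -/c exprS; congr (_ - _).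
rewrite /GRing.scale /=; ring.
Qed.

(** At r = m the power of m - r may fail to be differentiable, but it tends to 0 because q > 0. *)
Lemma sym_pow_diff_cvg (m q : R) (P : {poly R}) : 0 < m -> 0 < q ->
  sym_pow_diff m q P 0 x @[x --> m^'-] --> sym_pow_diff m q P 0 m.
Proof.
move=> m0 q0.
have E : sym_pow_diff m q P 0 = fun x => (m + x) `^ q + (m - x) `^ q - P.[x].
  by apply/funext => x; rewrite /sym_pow_diff big_ord0 expr0 !mul1r subr0.
rewrite E; apply: cvgB; last first.
  by apply: cvg_at_left_filter; apply: continuous_horner.
apply: cvgD.
  apply: cvg_at_left_filter.
  have mm0 : 0 < m + m by rewrite addr_gt0.
  exact: (continuous_of_is_derive (@is_derive1_comp R (fun y => y `^ q) (fun r => m + r) m _ _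
     (is_derive1_powR q mm0) (is_deriveD (is_derive_cst m m 1) (is_derive_id m 1)))).
rewrite subrr powR0 ?gt_eqF //.
apply: (@decreasing_cvg_at_left_comp R (fun x => m - x) (fun y => y `^ q) (BLeft 0) m 0).
- by rewrite /Order.lt /= .
- by move=> x y _ _ xy; rewrite ltrD2l ltrN2.
- by apply: cvg_at_left_filter; apply: cvgB; [exact: cvg_cst | exact: cvg_id].
- by rewrite subrr; exact: powR_cvg0.
Qed.

(** By [d + t%:R = m ^+ 2] the last node is the endpoint r = m. *)
Lemma alternating_sum_sym_pow (m d q : R) (t : nat) :
  0 < m -> 0 < d -> d + t%:R = m ^+ 2 -> 0 < q -> (forall n : nat, q != n%:R) ->
  \sum_(k < t.+1) (-1) ^+ k * 'C(t, k)%:R * sym_pow m q (Num.sqrt (d + k%:R)) != 0.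
Proof.
move=> m0 d0 dm q0 q_nat; apply/eqP => sum0.
have [t0|t0] := posnP t.
  move: sum0; rewrite t0 big_ord1 expr0 bin0 !mul1r addr0.
  move: dm; rewrite t0 addr0 => ->; rewrite sqrtr_sqr gtr0_norm //.
  rewrite /sym_pow subrr powR0 ?gt_eqF // addr0 => /eqP; apply/negP.
  by rewrite gt_eqF // powR_gt0 // addr_gt0.
pose D (k : nat) : R := d + k%:R.
have Dgt0 k : 0 < D k by rewrite ltr_pwDl.
have D_inj : injective D by move=> i j /addrI /eqP; rewrite eqr_nat => /eqP.
pose F k := sym_pow m q (Num.sqrt (D k)).
(* The interpolant uses the first t nodes; the vanishing alternating sum forces agreement at the
   last one. *)
pose P := \sum_(i < t) F i *: (tnth (t.-lagrange D) i : {poly R}).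
have szP : (size P <= t)%N.
  apply: leq_trans (size_sum _ _ _) _; apply/bigmax_leqP => i _.
  by apply: leq_trans (size_scale_leq _ _) _; rewrite size_lagrange_.
have PF k : (k <= t)%N -> P.[D k] = F k.
  have Plt j : (j < t)%N -> P.[D j] = F j.
    move=> jt; rewrite /P horner_sum (bigD1 (Ordinal jt)) //= hornerZ.
    have -> : D j = D (Ordinal jt) by [].
    rewrite lagrange_sample // eqxx mulr1 big1 ?addr0 // => i ij.
    by rewrite hornerZ lagrange_sample // (negPf ij) mulr0.
  rewrite leq_eqVlt => /orP[/eqP ->|]; last exact: Plt.
  have := alternating_sum_poly d szP; rewrite -[RHS]sum0 !big_ord_recr /=.
  under eq_bigr => i _ do rewrite [P.[_]](Plt i (ltn_ord i)).
  move=> /addrI; rewrite binn mulr1; apply: mulfI; by rewrite signr_eq0.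
pose Q := P \Po 'X^2.
pose G := sym_pow_diff m q Q.
have G0 r : G 0%N r = sym_pow m q r - P.[r ^+ 2].
  by rewrite /G /sym_pow_diff big_ord0 expr0 !mul1r subr0 /Q horner_comp hornerXn.
have zeroG k : (k <= t)%N -> G 0%N (Num.sqrt (D k)) = 0.
  by move=> kt; rewrite G0 sqr_sqrtr ?PF ?subrr // ltW.
have zeroGN k : (k <= t)%N -> G 0%N (- Num.sqrt (D k)) = 0.
  by move=> kt; rewrite G0 sqrrN sqr_sqrtr ?sym_powN ?PF ?subrr // ltW.
(* The 2t + 1 zeros in increasing order. The zero -m is left out, since all must lie to the right of
   -m. *)
pose z i := if (i < t)%N then - Num.sqrt (D (t.-1 - i)%N) else Num.sqrt (D (i - t)%N).
have sqrtD_lt i j : (i < j)%N -> Num.sqrt (D i) < Num.sqrt (D j).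
  by move=> ij; rewrite ltr_sqrt // ltrD2l ltr_nat.
have sqrtDt : Num.sqrt (D t) = m by rewrite /D dm sqrtr_sqr gtr0_norm.
have n_eq : (2 * t).-1.+1 = (2 * t)%N by rewrite prednK // muln_gt0.
have zlast : z (2 * t).-1.+1 = m.
  rewrite /z n_eq ltnNge mul2n -addnn leq_addr /= addnK //.
have [||||||x xm Gx] := @iterated_rolle R G (- m) m z (2 * t).-1.
- by move=> i x; exact: is_derive_sym_pow_diff.
- by rewrite zlast; exact: sym_pow_diff_cvg.
- move=> i; rewrite n_eq => it; rewrite /z.
  have [i1t|i1t] := ltnP i.+1 t.
    by rewrite (ltnW i1t) ltrN2 sqrtD_lt //; clear -i1t; lia.
  have [it'|it'] := ltnP i t; last by rewrite sqrtD_lt //; clear -it'; lia.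
  by apply: (@lt_trans _ _ 0); rewrite ?oppr_lt0 sqrtr_gt0.
- by rewrite /z t0 ltrN2 -sqrtDt sqrtD_lt // subn0 prednK.
- by rewrite zlast.
- move=> i; rewrite n_eq => it; rewrite /z; case: ltnP => it'.
    by rewrite zeroGN //; clear -t0; lia.
  by rewrite zeroG //; clear -it it'; lia.
move: Gx; rewrite n_eq /G /sym_pow_diff exprM sqrrN !expr1n mul1r.
(* Q has degree at most 2t - 2, so its 2t-th derivative vanishes. *)
rewrite derivn_poly0 ?horner0 ?subr0; last first.
  have := size_comp_poly P 'X^2; rewrite size_polyXn /= -/Q => szQ.
  by move: (size Q) (size P) szP szQ t0 => a b; clear; lia.
move/eqP; rewrite mulf_eq0 => /orP[|].
  rewrite prodf_seq_eq0 => /hasP[j _] /=; rewrite subr_eq0.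
  by apply/negP; exact: q_nat.
by move: xm => /andP[mx xm]; rewrite gt_eqF // addr_gt0 // powR_gt0; lra.
Qed.

End Nonvanishing.

(** * From streaming algorithms to one-way protocols *)

Section Averaging.
Local Open Scope classical_set_scope.
Local Open Scope ring_scope.
Context {R : realType} {d : measure_display} {W : measurableType d} (P : probability W R).

(** Integrate the pointwise bound: what holds for every fixed outcome of the coins passes to the sum
    of success probabilities. *)
Lemma sum_probability_le (I : finType) (g : I -> set W) (B : R) : 0 <= B ->
  (forall i, measurable (g i)) ->
  (forall w, \sum_i \1_(g i) w <= B) -> (\sum_i P (g i) <= B%:E)%E.
Proof.
move=> B0 mg gB.
have mi i : measurable_fun setT (EFin \o (\1_(g i) : W -> R)).
  by apply/measurable_EFinP; exact: measurable_indic.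
have i0 i w : setT w -> (0 <= (\1_(g i) w)%:E :> \bar R)%E.
  by move=> _; rewrite lee_fin indicE.
have -> : (\sum_i P (g i) = \int[P]_w \sum_i (\1_(g i) w)%:E)%E.
  rewrite (ge0_integral_sum P measurableT mi i0).
  by apply: eq_bigr => i _; rewrite integral_indic // setIT.
apply: (@le_trans _ _ (\int[P]_w (cst B%:E w))%E).
  apply: ge0_le_integral => //.
  - by move=> w _; apply: sume_ge0 => i _; exact: i0.
  - by apply: emeasurable_sum => i; exact: mi.
  - by move=> w _; rewrite sumEFin lee_fin.
rewrite integral_cst // -[leRHS]mule1 lee_wpmul2l ?lee_fin //; exact: probability_le1.
Qed.

End Averaging.

Section Measurability.
Local Open Scope classical_set_scope.
Local Open Scope ring_scope.
Context {R : realType} {d : measure_display} {W : measurableType d}.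

Lemma measurable_finite_fibers (T : finType) (f : W -> T) (B : T -> set W) :
  (forall m, measurable [set w | f w = m]) -> (forall m, measurable (B m)) ->
  measurable [set w | B (f w) w].
Proof.
move=> mf mB.
have -> : [set w | B (f w) w] = \bigcup_(m in [set: T]) ([set w | f w = m] `&` B m).
  apply/seteqP; split => w /=; first by exists (f w).
  by move=> [m _ [/= <-]].
by apply: fin_bigcup_measurable => [|m _]; [exact: finite_finset | exact: measurableI].
Qed.

Context {N b : nat} (A : streaming_algorithm (R := R) W N b).

Lemma measurable_run_from (s : seq (update (R := R) N)) (k : nat) (f : W -> b.-tuple bool) :
  (forall m, measurable [set w | f w = m]) ->
  forall m, measurable [set w | run_from A w k (f w) s = m].
Proof.
elim: s k f => [//|u s IH] k f mf m /=.
apply: (IH k.+1 (fun w => step A k w (f w) u)) => m'.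
by apply: (@measurable_finite_fibers _ f (fun y => [set w | step A k w y u = m'])) => // y;
  exact: measurable_step.
Qed.

Lemma measurable_good_event (F : 'M[R]_N -> R) (c : R) (s : seq (update (R := R) N)) :
  measurable (good_event A F c s).
Proof.
pose B m := [set w | (1 - c) * F (stream_matrix s) <= output A w m <= (1 + c) * F (stream_matrix s)].
apply: (@measurable_finite_fibers _ (fun w => run_from A w 0 (init A w) s) B).
  by move=> m; apply: measurable_run_from; exact: measurable_init.
move=> m; have := measurable_output A m measurableT
  (measurable_itv `[(1 - c) * F (stream_matrix s), (1 + c) * F (stream_matrix s)]).
by rewrite setTI; congr measurable; apply/seteqP; split => w /=; rewrite in_itv.
Qed.

(** The memory between the two streams is the message of a one-way protocol, with [w] as shared
    randomness. *)
Lemma run_from_cat (w : W) (s1 s2 : seq (update (R := R) N)) (k : nat) (m : b.-tuple bool) :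
  run_from A w k m (s1 ++ s2) = run_from A w (k + size s1) (run_from A w k m s1) s2.
Proof.
elim: s1 k m => [|u s1 IH] k m /=; first by rewrite addn0.
by rewrite IH addSnnS.
Qed.

End Measurability.

Section Reduction.
Context {R : realType}.

Definition parity_power (J : finType) (p : R) (b : bool) : R :=
  \sum_(y : {set J} | odd #|y| == b) (gadget_power (J := J) p #|y| - 1).

(** The difference is an alternating sum over all subsets, hence a finite difference of order |J| of
    the gadget powers. *)
Lemma parity_power_neq (J : finType) (p : R) : (1 < #|J|)%N -> 0 < p ->
  (forall n : nat, p != (2 * n)%:R) -> parity_power J p false != parity_power J p true.
Proof.
move=> J1 p0 pn; rewrite -subr_eq0.
have -> : parity_power J p false - parity_power J p true =
    \sum_(y : {set J}) (-1) ^+ #|y| * (gadget_power (J := J) p #|y| - 1).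
  rewrite [RHS](bigID (fun y : {set J} => odd #|y| == false)) /= /parity_power; congr (_ + _).
    by apply: eq_bigr => y /eqP yo; rewrite -signr_odd yo mul1r.
  rewrite -sumrN; apply: eq_big => [y|y /eqP yo]; first by case: (odd _).
  by rewrite -signr_odd yo mulN1r.
rewrite (sum_sets_by_card J (fun k => (-1) ^+ k * (gadget_power (J := J) p k - 1))).
(* The constants -1 cancel, forming a polynomial of degree 0 < |J|. *)
have one0 : \sum_(k < #|J|.+1) (-1) ^+ k * 'C(#|J|, k)%:R * (1 : {poly R}).[0 + k%:R] = 0.
  by apply: alternating_sum_poly; rewrite size_poly1 ltnW.
have -> : \sum_(k < #|J|.+1) 'C(#|J|, k)%:R * ((-1) ^+ k * (gadget_power (J := J) p k - 1)) =
    \sum_(k < #|J|.+1) (-1) ^+ k * 'C(#|J|, k)%:R * gadget_power (J := J) p k.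
  rewrite -[RHS]subr0 -[X in _ = _ - X]one0 -sumrB.
  by apply: eq_bigr => k _; rewrite hornerC; ring.
have t1 : 1 < #|J|%:R :> R by rewrite ltr1n.
apply: alternating_sum_sym_pow.
- by lra.
- by rewrite exprn_gt0 //; lra.
- by field.
- by lra.
- move=> n; apply: contraNneq (pn n) => /eqP; rewrite eq_sym => /eqP p2; apply/eqP.
  by rewrite natrM p2 mulrCA divff ?mulr1 // pnatr_eq0.
Qed.

(** Success probabilities are summed over all [x], [s] and hidden bits. The sum is at least q times
    the number of instances; for fixed coins a correct output reveals the bit to Bob, which
    [total_advantage_le] limits. *)
Lemma success_probability_le (V E J : finType) (N b c' : nat) (p c q v eps : R) (D : set R)
    (pos : E * J -> V) (iota : (V * {set J} * bool) + (E * {set J}) -> 'I_N)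
    (d : measure_display) (W : measurableType d) (P : probability W R)
    (A : streaming_algorithm (R := R) W N b) :
  injective pos -> injective iota ->
  (1 < #|J|)%N -> (0 < #|E|)%N -> #|V| = (64 * #|J| * #|E|)%N ->
  0 < p -> 0 < c -> D 0 -> D 1 ->
  let value b' := (64 * #|J| * 2 ^ #|J|)%:R + parity_power J p b' in
  c * (`|value false| + `|value true|) < `|value false - value true| ->
  0 <= v -> v <= 16^-1 -> c'%:R ^+ #|J| <= v * #|E|%:R ^+ #|J|.-1 ->
  0 <= eps -> #|E|%:R^-1 + 16 * v <= eps ^+ 2 ->
  approximates A P (schatten_pow p) c q D ->
  q * 2 <= 1 + (eps + 2 ^+ b / 2 ^+ c').
Proof.
move=> pos_inj iota_inj t1 m0 nE p0 c0 D0 D1 value sep v0 v1 hc eps0 heps HA.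
have schattenE x s b' : schatten_pow p (stream_matrix (instance_stream pos iota x s b')) =
    #|E|%:R * value b'.
  rewrite schatten_pow_instance ?(ltnW t1) // /value mulrDr; congr (_ + _).
  by rewrite -natrM nE mulnAC mulnC.
pose g (i : {set V} * {perm V} * bool) : set W :=
  good_event A (schatten_pow p) c (instance_stream pos iota i.1.1 i.1.2 i.2).
pose B : R := (#|V|)`!%:R * 2 ^+ #|V| * (1 + (eps + 2 ^+ b / 2 ^+ c')).
have B0 : 0 <= B.
  by rewrite !mulr_ge0 ?exprn_ge0 // !addr_ge0 ?divr_ge0 ?exprn_ge0.
have upper : (\sum_i P (g i) <= B%:E)%E.
  apply: sum_probability_le => // [i|w]; first exact: measurable_good_event.
  pose tau x := run_from A w 0 (init A w) (unit_stream (alice_positions iota x)).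
  (* Bob tests whether the output lies in the window of the hidden bit [false]; [sep] keeps the two
     windows disjoint. *)
  pose guess (mu : b.-tuple bool) s z :=
    (1 - c) * (#|E|%:R * value false)
    <= output A w (run_from A w (#|V| * 2 ^ #|J|) mu (unit_stream (bob_positions pos iota s z)))
    <= (1 + c) * (#|E|%:R * value false).
  have runE x s b' : run A w (instance_stream pos iota x s b') =
      output A w (run_from A w (#|V| * 2 ^ #|J|) (tau x)
        (unit_stream (bob_positions pos iota s (bob_input pos s x b')))).
    by rewrite /run /instance_stream run_from_cat /= size_map alice_positions_size.
  have G0 x s : \1_(g (x, s, false)) w <= (guess (tau x) s (parities pos s x))%:R :> R.
    rewrite indicE; case: (boolP (w \in _)) => [|_]; last by rewrite ler0n.
    by rewrite inE /g /good_event /= schattenE runE /= /guess => ->.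
  have G1 x s : \1_(g (x, s, true)) w <= 1 - (guess (tau x) s (~: parities pos s x))%:R :> R.
    rewrite indicE; case: (boolP (w \in _)) => [|_]; last by case: (guess _ _ _); rewrite /= ?subrr ?subr0.
    rewrite inE /g /good_event /= schattenE runE /=.
    set y := output _ _ _ => h1; rewrite /guess -/y.
    case: (boolP (_ <= y <= _)) => [h0|_]; last by rewrite subr0.
    exfalso; move: h0 h1 sep; clear -m0 c0.
    have mR : 0 < #|E|%:R :> R by rewrite ltr0n.
    move: (value false) (value true) => a0 a1 /andP[l0 u0] /andP[l1 u1].
    have : #|E|%:R * `|a0 - a1| <= #|E|%:R * (c * (`|a0| + `|a1|)).
      have -> : #|E|%:R * `|a0 - a1| = `|#|E|%:R * a0 - #|E|%:R * a1|.
        by rewrite -mulrBr normrM (gtr0_norm mR).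
      have -> : #|E|%:R * (c * (`|a0| + `|a1|)) = c * `|#|E|%:R * a0| + c * `|#|E|%:R * a1|.
        by rewrite !normrM (gtr0_norm mR); ring.
      move: (#|E|%:R * a0) (#|E|%:R * a1) l0 u0 l1 u1 => e0 e1 l0 u0 l1 u1.
      (* A window around a negative value is empty. *)
      have n0 : c * e0 <= c * `|e0|.
        have [e00|e00] := ger0P e0; first by [].
        by exfalso; have : c * e0 < 0; [rewrite pmulr_rlt0 | lra].
      have n1 : c * e1 <= c * `|e1|.
        have [e10|e10] := ger0P e1; first by [].
        by exfalso; have : c * e1 < 0; [rewrite pmulr_rlt0 | lra].
      by rewrite ler_norml; apply/andP; split; lra.
    by rewrite ler_pM2l // leNgt => /negbTE ->.
  have G01 x s : \1_(g (x, s, true)) w + \1_(g (x, s, false)) w <=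
      1 + ((guess (tau x) s (parities pos s x))%:R - (guess (tau x) s (~: parities pos s x))%:R) :> R.
    by rewrite addrCA addrC lerD.
  rewrite -(pair_big xpredT xpredT (fun xs b' => \1_(g (xs, b')) w)) /=.
  rewrite -(pair_big xpredT xpredT (fun x s => \sum_b' \1_(g (x, s, b')) w)) /=.
  apply: (@le_trans _ _ (\sum_(x : {set V}) \sum_(s : {perm V})
     (1 + ((guess (tau x) s (parities pos s x))%:R - (guess (tau x) s (~: parities pos s x))%:R)))).
    apply: ler_sum => x _; apply: ler_sum => s _; rewrite big_bool; exact: G01.
  under eq_bigr do rewrite big_split /=.
  rewrite big_split /= /B mulrDr mulr1; apply: lerD.
    rewrite !sumr_const card_perm_type card_set_type.
    by rewrite -[_ *+ (2 ^ _)]mulr_natr natrX.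
  have := @total_advantage_le R V E J pos pos_inj (b.-tuple bool : finType) tau guess c' v eps.
  rewrite card_tuple card_bool natrX.
  by apply.
have lower : ((((#|V|)`! * 2 ^ #|V| * 2)%:R * q)%:E <= \sum_i P (g i))%E.
  have -> : ((#|V|)`! * 2 ^ #|V| * 2)%N = #|{: {set V} * {perm V} * bool}|.
    by rewrite !card_prod card_bool card_perm_type card_set_type; congr (_ * _)%N; rewrite mulnC.
  rewrite mulr_natl -sumr_const -sumEFin; apply: lee_sum => i _; apply: HA.
  exact: instance_stream_over.
have := le_trans lower upper; rewrite lee_fin /B !natrM natrX.
rewrite -mulrA ler_pM2l ?mulr_gt0 ?exprn_gt0 ?ltr0n ?fact_gt0 //.
by rewrite mulrC.
Qed.

End Reduction.

(** * Choice of the constants *)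

Local Open Scope classical_set_scope.
Local Open Scope ring_scope.

Lemma exists_injective (T : finType) (N : nat) :
  (#|T| <= N)%N -> exists f : T -> 'I_N, injective f.
Proof.
move=> le; exists (fun y => widen_ord le (enum_rank y)) => y y' /(congr1 val) /= yy.
by apply: enum_rank_inj; apply: val_inj.
Qed.

Lemma exists_nat_ge {R : realType} (a : R) : exists n : nat, a <= n%:R.
Proof. by exists (Num.truncn `|a|).+1; apply: le_trans (ler_norm _) (ltW (truncnS_gt _)). Qed.

Lemma powR_expn {R : realType} (m : R) (t : nat) : 0 <= m -> (0 < t)%N ->
  (m `^ (1 - t%:R^-1)) ^+ t = m ^+ t.-1.
Proof.
move=> m0 t0; rewrite -powR_mulrn ?powR_ge0 // -powRrM mulrBl mul1r mulVf ?pnatr_eq0 -?lt0n //.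
by rewrite -[X in X%:R - 1](prednK t0) -natr1 addrK powR_mulrn.
Qed.

(* With [m] hyperedges the threshold [C N^(1-1/t)] is at most [(v / 2) m^(1-1/t)], which leaves
   room for [l] extra bits once [m >= (2 l / v)^t]. *)
Lemma memory_budget {R : realType} (t K N b l : nat) (v : R) :
  (1 < t)%N -> (0 < K)%N -> 0 < v -> v <= 1 -> (K <= N)%N ->
  b%:R < v / (4 * K%:R) * N%:R `^ (1 - t%:R^-1) ->
  (2 * l%:R / v) ^+ t <= (N %/ K)%:R ->
  (b + l)%:R ^+ t <= v * (N %/ K)%:R ^+ t.-1.
Proof.
move=> t1 K0 v0 v1 KN hb hl; have t0 := ltnW t1; set m := (N %/ K)%N.
pose e : R := 1 - t%:R^-1; rewrite -/e in hb.
have m0 : (0 < m)%N by rewrite divn_gt0.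
have KR : 1 <= K%:R :> R by rewrite ler1n.
have e0 : 0 <= e by rewrite subr_ge0 invf_le1 ?ltr0n // ler1n.
have e1 : e <= 1 by rewrite gerBl invr_ge0.
pose M : R := m%:R `^ e.
have M0 : 0 <= M by exact: powR_ge0.
have Mt : M ^+ t = m%:R ^+ t.-1 by exact: powR_expn.
(* N <= 2Km because m >= 1, and (2K)^e <= 2K because e <= 1. *)
have NM : N%:R `^ e <= 2 * K%:R * M.
  apply: (@le_trans _ _ ((2 * K%:R * m%:R) `^ e)).
    apply: ge0_ler_powR; rewrite ?nnegrE ?mulr_ge0 //.
    rewrite -!natrM ler_nat.
    apply: leq_trans (ltnW (ltn_ceil N K0)) _; rewrite -/m mulnAC leq_mul2r mul2n -addnn.
    by rewrite -addn1 leq_add2l m0 orbT.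
  rewrite powRM ?mulr_ge0 // ler_wpM2r //.
  by rewrite -[leRHS]powRr1 ?mulr_ge0 //; apply: ler_powR => //; lra.
have lM : 2 * l%:R / v <= M.
  rewrite -(@ler_pXn2r _ t) ?nnegrE ?divr_ge0 ?mulr_ge0 ?(ltW v0) // Mt.
  by apply: le_trans hl _; rewrite ler_eXnr ?ler1n //; case: (t) t1 => [|[]].
have bl : (b + l)%:R <= v * M.
  have : b%:R <= v / 2 * M.
    apply: le_trans (ltW hb) _; apply: le_trans (ler_wpM2l _ NM) _.
      by rewrite divr_ge0 ?(ltW v0) // mulr_ge0.
    by rewrite le_eqVlt; apply/orP; left; apply/eqP; field; rewrite gt_eqF //; lra.
  move: lM; rewrite ler_pdivrMr // natrD; lra.
rewrite -Mt; apply: (@le_trans _ _ ((v * M) ^+ t)).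
  by apply: lerXn2r; rewrite ?nnegrE ?mulr_ge0 ?(ltW v0).
by rewrite exprMn ler_wpM2r ?exprn_ge0 // ler_iXnr // ltW.
Qed.

Theorem theorem5 (R : realType) (p : R) (p_gt0 : 0 < p)
    (p_not_even : forall k : int, p != (2 * k)%:~R)
    (t : nat) (t_gt0 : (0 < t)%N) (t_even : ~~ odd t) :
  exists2 c : R, 0 < c &
  forall q : R, 2^-1 < q ->
  exists2 C : R, 0 < C &
  exists N0 : nat, forall N : nat, (N0 <= N)%N ->
  forall D : set R, (forall z : int, `|z| <= N%:Z -> D z%:~R) ->
  forall (b : nat) (d : measure_display) (W : measurableType d)
    (P : probability W R) (A : streaming_algorithm (R := R) W N b),
  approximates A P (schatten_pow p) c q D ->
  C * N%:R `^ (1 - t%:R^-1) <= b%:R.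
Proof.
have t2 : (1 < t)%N by case: (t) t_gt0 t_even => [|[]].
have t1 : (1 < #|'I_t|)%N by rewrite card_ord.
have pn n : p != (2 * n)%:R by have := p_not_even n; rewrite intrM natrM.
have hne := @parity_power_neq R 'I_t p t1 p_gt0 pn.
pose value b' : R := (64 * t * 2 ^ t)%:R + parity_power 'I_t p b'.
pose gap := `|value false - value true|.
have gap0 : 0 < gap by rewrite normr_gt0 opprD addrACA subrr add0r subr_eq0.
(* Small enough to separate the windows of the two values; the added 1 keeps the denominator
   positive. *)
pose c := gap / (2 * (`|value false| + `|value true| + 1)).
have S0 : 0 <= `|value false| + `|value true| by rewrite addr_ge0.
have c0 : 0 < c by rewrite divr_gt0 // mulr_gt0 //; lra.
have sep : c * (`|value false| + `|value true|) < gap.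
  rewrite /c mulrAC ltr_pdivrMr; last by lra.
  by rewrite ltr_pM2l //; lra.
(* The bound obtained at the end is 2q <= 1 + 2 eps, which contradicts 2q - 1 = 4 eps > 0. *)
exists c => // q q2; pose eps := (2 * q - 1) / 4.
have eps0 : 0 < eps by rewrite /eps; lra.
(* Of the budget eps^2, one half goes to 16 v and the other to 1 / m. *)
pose v := Num.min 16^-1 (eps ^+ 2 / 32).
have v0 : 0 < v by rewrite lt_min divr_gt0 ?exprn_gt0 // andbT; lra.
have v16 : v <= 16^-1 by rewrite ge_min lexx.
have veps : v <= eps ^+ 2 / 32 by rewrite ge_min lexx orbT.
(* Spare bits: with density threshold 2^-(b + l) the rare memory states contribute at most 2^-l <=
   eps. *)
have [l lE] := exists_nat_ge eps^-1.
have l2 : (2 ^+ l)^-1 <= eps.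
  rewrite invf_ple ?posrE ?exprn_gt0 //; apply: le_trans lE _.
  by rewrite -natrX ler_nat ltnW // ltn_expl.
have [m1 m1E] := exists_nat_ge (2 / eps ^+ 2).
have [m2 m2E] := exists_nat_ge ((2 * l%:R / v) ^+ t).
(* Indices per hyperedge: 64 t vertices, each with 2 columns for every one of 2^t sets, and 2^t
   candidate gadget rows. *)
pose K := (64 * t * (2 * 2 ^ t) + 2 ^ t)%N.
have K0 : (0 < K)%N by rewrite addn_gt0 expn_gt0 orbT.
exists (v / (4 * K%:R)); first by rewrite divr_gt0 // mulr_gt0 // ltr0n.
(* Hence m exceeds [m1], which makes 1 / m small, and [m2], which [memory_budget] requires. *)
exists (K * (m1 + m2).+1)%N => N N0 D HD b d W P A HA.
rewrite leNgt; apply/negP => hb.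
have mN : ((m1 + m2).+1 <= N %/ K)%N by rewrite leq_divRL // mulnC.
set m := (N %/ K)%N in mN.
have KN : (K <= N)%N by apply: leq_trans N0; rewrite leq_pmulr.
have [iota iota_inj] : exists f : ('I_(64 * t * m) * {set 'I_t} * bool) + ('I_m * {set 'I_t}) -> 'I_N,
    injective f.
  apply: exists_injective; rewrite card_sum !card_prod !card_set_type card_bool !card_ord.
  apply: leq_trans (leq_divM N K); rewrite -/m /K; move: (m) (2 ^ t)%N => a e; clear; lia.
have [pos pos_inj] : exists f : 'I_m * 'I_t -> 'I_(64 * t * m), injective f.
  by apply: exists_injective; rewrite card_prod !card_ord -mulnA [(t * m)%N]mulnC leq_pmull.
have D0 : D 0 by have := HD 0; rewrite normr0; apply.
have D1 : D 1 by have := HD 1; rewrite normr1 => /(_ _); apply; exact: leq_trans K0 KN.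
have m0 : (0 < m)%N by exact: leq_trans mN.
have budget : (b + l)%:R ^+ t <= v * m%:R ^+ t.-1.
  apply: memory_budget => //; first by clear -v16; lra.
  by apply: le_trans m2E _; rewrite ler_nat; apply: leq_trans mN; rewrite leqW // leq_addl.
have small : m%:R^-1 + 16 * v <= eps ^+ 2.
  have : m%:R^-1 <= eps ^+ 2 / 2.
    rewrite invf_ple ?posrE ?divr_gt0 ?exprn_gt0 ?ltr0n //.
    by rewrite invf_div; apply: le_trans m1E _; rewrite ler_nat; apply: leq_trans mN; rewrite leqW // leq_addr.
  by move=> m_eps; clear -veps m_eps; lra.
have := @success_probability_le R 'I_(64 * t * m) 'I_m 'I_t N b (b + l) p c q v eps D pos iota d W P A
  pos_inj iota_inj t1.
rewrite !card_ord => /(_ _ erefl p_gt0 c0 D0 D1 sep (ltW v0) v16 budget (ltW eps0) small HA).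
have -> : 2 ^+ b / 2 ^+ (b + l) = (2 ^+ l)^-1 :> R.
  by rewrite exprD invfM mulrA divff ?mul1r // expf_neq0 // pnatr_eq0.
by move=> /(_ m0); rewrite /eps in l2 *; move=> H; clear -H l2 q2; lra.
Qed.
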